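(* Let $\mathcal G=(\Gamma_j)_{j\in J}$ be a countable family of lattices in $G$ and let $(g_j)_{j\in J}\subset L^2(G)$. Suppose that $(T_\gamma g_j)_{j\in J,\gamma\in\Gamma_j}$ is a frame for $L^2(G)$, with lower and upper frame bounds $A_g$ and $B_g$, which satisfies the $1$-UCP. Then $$BW(\mathcal G):=\sum_{j\in J}\frac{1}{\operatorname{covol}(\Gamma_j)}\ \ge\ \frac{A_g}{B_g}\,\mu_{\widehat G}(\widehat G).$$ In particular, if $G$ is non-discrete, then $BW(\mathcal G)=\infty$.
   Context: $G$ is a second countable locally compact abelian group, written additively, with Haar measure $\mu_G$; $\widehat G$ is its dual group, with Haar measure $\mu_{\widehat G}$ normalized so that the Fourier transform $\hat f(\omega)=\int_G f(x)\overline{\langle x,\omega\rangle}\,dx$ extends to a unitary map $L^2(G)\to L^2(\widehat G)$. A lattice in $G$ is a discrete subgroup $\Gamma$ with $G/\Gamma$ compact; $\operatorname{covol}(\Gamma)$ is the $\mu_G$-measure of any fundamental domain of $\Gamma$ (a Borel set whose $\Gamma$-translates tile $G$ up to null sets). $T_\gamma f=f(\cdot-\gamma)$. A family $(\eta_i)_{i\in I}$ in a Hilbert space $\mathcal H$ is a frame with lower bound $A>0$ and upper bound $B$ if $A\|f\|^2\le\sum_i|\langle f,\eta_i\rangle|^2\le B\|f\|^2$ for all $f\in\mathcal H$. Fix a closed set $E\subset\widehat G$ of measure zero (the blind spot), and let $\mathcal D_E$ be the set of $f\in L^2(G)$ such that $\hat f\in L^\infty(\widehat G)$ and there is a compact $K\subset\widehat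 G\setminus E$ with $\hat f\mathbf 1_K=\hat f$ a.e. For $f\in\mathcal D_E$ put $w_{f;g,j}(x)=\sum_{\gamma\in\Gamma_j}|\langle T_xf,T_\gamma g_j\rangle|^2$ (a trigonometric polynomial on $G$) and $w_{f;g}(x)=\sum_{j\in J}w_{f;g,j}(x)\in[0,\infty]$, $x\in G$. $\mathcal A(G)$ is the space of almost periodic functions: those $f\in C_b(G)$ for which $\{T_xf:x\in G\}$ is relatively compact in the uniform norm. The mean of $f\in\mathcal A(G)$ is $M(f)=\lim_n\mu_G(H_n)^{-1}\int_{H_n}f\,d\mu_G$, for any sequence of open relatively compact sets $H_n$ with $\bigcup_nH_n=G$ and $\mu_G((x+H_n)\cap(G\setminus H_n))/\mu_G(H_n)\to0$ for all $x\in G$; the mean is independent of the sequence. The system $(T_\gamma g_j)_{j,\gamma}$ fulfills the $1$-UCP (unconditional convergence property) if for all $f\in\mathcal D_E$: $w_{f;g}\in\mathcal A(G)$, and for every $\varepsilon>0$ there is a finite $J'\subset J$ such that for all finite $J''$ with $J'\subset J''\subset J$, $M\big(|w_{f;g}-\sum_{j\in J''}w_{f;g,j}|\big)<\varepsilon$. *)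

(* Defs.v *)
From HB Require Import structures.
From mathcomp Require Import all_boot all_order all_algebra finmap.
From mathcomp Require Import ring_quotient.
From mathcomp Require Import all_classical all_reals all_analysis.
From mathcomp Require Import complex.

Set Implicit Arguments.
Unset Strict Implicit.
Unset Printing Implicit Defensive.

Import Order.TTheory GRing.Theory Num.Theory.
Import numFieldNormedType.Exports.
Import ComplexField.Normc.

Local Open Scope classical_set_scope.
Local Open Scope ring_scope.
Local Open Scope complex_scope.

(* [R[i]] carries no topology in the libraries; this is its norm topology. *)
#[export, non_forgetful_inheritance]
HB.instance Definition _ (R : realType) :=
  PseudoPointedMetric.copy R[i] (R[i] : numFieldType)^o.

(* Measurable types are pointed in the library, which a topological group is
   not: [borel G] is [G] pointed at 0, with its Borel sigma-algebra. *)
Definition borel (G : PreTopologicalZmodule.type) : Type := G.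

Section borel_instances.
Context (G : PreTopologicalZmodule.type).

HB.instance Definition _ := PreTopologicalZmodule.on (borel G).
HB.instance Definition _ := isPointed.Build (borel G) (0 : G).
HB.instance Definition _ :=
  @isMeasurable.Build (sigma_display (@open G)) (borel G) <<s @open G >>
    (@sigma_algebra0 _ setT (@open G)) (@sigma_algebraC (borel G) (@open G))
    (@sigma_algebra_bigcup _ setT (@open G)).

End borel_instances.

Section haar.
Context {R : realType} {G : PreTopologicalZmodule.type}.

(* A Haar measure is a nonzero translation-invariant Radon measure. *)
Record haar_measure (mu : {measure set (borel G) -> \bar R}) : Prop :=
  HaarMeasure {
    haar_neq0 : mu [set: G] != 0%E ;
    haar_shift : forall (x : G) (A : set (borel G)), measurable A ->
      mu [set x + a | a in A] = mu A ;
    haar_compact : forall K : set G, compact K -> (mu K < +oo)%E ;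
    haar_outer : forall A : set (borel G), measurable A ->
      mu A = ereal_inf [set mu U | U in [set U : set G | open U /\ A `<=` U]] ;
    haar_inner : forall U : set G, open U ->
      mu U = ereal_sup [set mu K | K in [set K : set G | compact K /\ K `<=` U]]
  }.

End haar.

Section dual_group.
Context (R : realType) (G : topologicalZmodType).

Record dual := Character {
  char_fun :> G -> R[i] ;
  charD : forall x y, char_fun (x + y) = char_fun x * char_fun y ;
  char_norm : forall x, normc (char_fun x) = 1 ;
  char_continuous : continuous char_fun
}.

HB.instance Definition _ := gen_eqMixin dual.
HB.instance Definition _ := gen_choiceMixin dual.
HB.instance Definition _ := Topological.copy dual
  (initial_topology (char_fun : dual -> {compact-open, G -> R[i]})).

Lemma char_eq (a b : dual) : a =1 b -> a = b.
Proof.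
case: a => f fD f1 fc; case: b => g gD g1 gc /= /funext fg.
by subst g; congr Character; exact: Prop_irrelevance.
Qed.

Lemma char0 (a : dual) : a 0 = 1.
Proof.
have a0 : a 0 != 0.
  apply/eqP => a00; have := char_norm a 0.
  by rewrite a00 normc0 => /esym/eqP; rewrite oner_eq0.
by apply: (mulfI a0); rewrite -charD addr0 mulr1.
Qed.

Program Definition dual_zero : dual := @Character (fun=> 1) _ _ _.
Next Obligation. by move=> x y; rewrite mulr1. Qed.
Next Obligation. by move=> x; rewrite normc1. Qed.
Next Obligation. by move=> x; exact: cvg_cst. Qed.

Program Definition dual_add (a b : dual) : dual :=
  @Character (fun x => a x * b x) _ _ _.
Next Obligation. by move=> a b x y /=; rewrite !charD mulrACA. Qed.
Next Obligation. by move=> a b x /=; rewrite normcM !char_norm mulr1. Qed.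
Next Obligation.
move=> a b x.
exact: (@cvgM (R[i] : numFieldType) G (nbhs x) _ a b (a x) (b x)
  (@char_continuous a x) (@char_continuous b x)).
Qed.

Program Definition dual_opp (a : dual) : dual :=
  @Character (fun x => a (- x)) _ _ _.
Next Obligation. by move=> a x y /=; rewrite opprD charD. Qed.
Next Obligation. by move=> a x; exact: char_norm. Qed.
Next Obligation.
move=> a x; apply: continuous_comp; first exact: opp_continuous.
exact: char_continuous.
Qed.

Lemma dual_addA : associative dual_add.
Proof. by move=> a b c; apply: char_eq => x /=; rewrite mulrA. Qed.

Lemma dual_addC : commutative dual_add.
Proof. by move=> a b; apply: char_eq => x /=; rewrite mulrC. Qed.

Lemma dual_add0 : left_id dual_zero dual_add.
Proof. by move=> a; apply: char_eq => x /=; rewrite mul1r. Qed.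

Lemma dual_addN : left_inverse dual_zero dual_opp dual_add.
Proof. by move=> a; apply: char_eq => x /=; rewrite -charD addNr char0. Qed.

HB.instance Definition _ :=
  GRing.isZmodule.Build dual dual_addA dual_addC dual_add0 dual_addN.

End dual_group.

Section L2.
Context {R : realType} {d : measure_display} {T : measurableType d}.
Variable mu : {measure set T -> \bar R}.
Implicit Types f g h : T -> R[i].

Definition cmeasurable f :=
  measurable_fun setT (fun x => complex.Re (f x)) /\
  measurable_fun setT (fun x => complex.Im (f x)).

Definition cintegral f : R[i] :=
  Rintegral mu setT (fun x => complex.Re (f x)) +i*
  Rintegral mu setT (fun x => complex.Im (f x)).

Definition L1 f :=
  cmeasurable f /\ (\int[mu]_x (normc (f x))%:E < +oo)%E.

Definition l2norm2 f : \bar R := \int[mu]_x (normc (f x) ^+ 2)%:E.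

Definition L2 f := cmeasurable f /\ (l2norm2 f < +oo)%E.

Definition inner f g : R[i] := cintegral (fun x => f x * (g x)^*).

Definition ae_eqc f g := {ae mu, forall x, f x = g x}.

Definition Linfty f :=
  cmeasurable f /\ exists M : R, {ae mu, forall x, normc (f x) <= M}.

(* The family is [eta] restricted to the index set [I]. *)
Definition frame (K : choiceType) (I : set K) (eta : K -> T -> R[i])
    (A B : R) :=
  0 < A /\ forall f, L2 f ->
    (A%:E * l2norm2 f <= \esum_(i in I) (normc (inner f (eta i)) ^+ 2)%:E)%E /\
    (\esum_(i in I) (normc (inner f (eta i)) ^+ 2)%:E <= B%:E * l2norm2 f)%E.

End L2.

Section fourier.
Context {R : realType} {G : topologicalZmodType}.
Variables (mu : {measure set (borel G) -> \bar R})
          (muhat : {measure set (borel (dual R G)) -> \bar R}).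

Definition fourier (f : G -> R[i]) (w : dual R G) : R[i] :=
  cintegral mu (fun x : borel G => f x * (w x)^*).

(* [F] is the Fourier-Plancherel transform, acting on representatives of
   L^2-classes: it agrees with [fourier] on the intersection of L^1 and L^2
   and induces a unitary map from L^2(G) onto L^2 of the dual.  Such an [F]
   exists exactly when [muhat] is normalized relatively to [mu], and it is then
   unique up to null sets. *)
Record fourier_plancherel (F : (G -> R[i]) -> dual R G -> R[i]) : Prop :=
  FourierPlancherel {
    plancherel_L2 : forall f, L2 mu f -> L2 muhat (F f) ;
    plancherel_linear : forall (a : R[i]) f g, L2 mu f -> L2 mu g ->
      ae_eqc muhat (F (fun x => a * f x + g x)) (fun w => a * F f w + F g w) ;
    plancherel_inner : forall f g, L2 mu f -> L2 mu g ->
      inner muhat (F f) (F g) = inner mu f g ;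
    plancherel_surj : forall h, L2 muhat h ->
      exists2 f, L2 mu f & ae_eqc muhat (F f) h ;
    plancherel_fourier : forall f, L1 mu f -> L2 mu f ->
      ae_eqc muhat (F f) (fourier f)
  }.

(* The test space D_E of functions whose transform is bounded and supported in
   a compact set off the blind spot [E]. *)
Definition test_fun (F : (G -> R[i]) -> dual R G -> R[i])
    (E : set (dual R G)) (f : G -> R[i]) :=
  [/\ L2 mu f, Linfty muhat (F f) &
    exists K : set (dual R G), [/\ compact K, K `<=` ~` E &
      ae_eqc muhat (fun w => F f w * (\1_K w)%:C) (F f)]].

End fourier.

Section lattices.
Context {G : topologicalZmodType}.

Definition discrete_subset (A : set G) := A `<=` isolated A.

Definition lattice (Gam : zmodClosed G) :=
  discrete_subset [set` Gam] /\ compact [set: quotient_topology (Quotient.quot Gam)].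

Context {R : realType}.
Variable mu : {measure set (borel G) -> \bar R}.

Definition fundamental_domain (Gam : zmodClosed G) (D : set (borel G)) :=
  [/\ measurable D,
    (forall c, c \in Gam -> c != 0 ->
      mu (D `&` [set c + x | x in D]) = 0%E) &
    mu (~` \bigcup_(c in [set` Gam]) [set c + x | x in D]) = 0%E].

(* All fundamental domains of a lattice have the same measure. *)
Definition covol (Gam : zmodClosed G) : \bar R :=
  get [set mu D | D in fundamental_domain Gam].

Definition bandwidth (J : countType) (Gam : J -> zmodClosed G) : \bar R :=
  \esum_(j in [set: J]) (covol (Gam j))^-1%E.

End lattices.

Section almost_periodic.
Context {R : realType} {G : topologicalZmodType}.

Definition translate (V : Type) (x : G) (f : G -> V) : G -> V :=
  fun y => f (y - x).

Definition almost_periodic (V : normedModType R) (f : G -> V) :=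
  [/\ continuous f, [bounded f x | x in [set: G]] &
    precompact ([set translate x f | x in [set: G]] : set {uniform G -> V})].

Variable mu : {measure set (borel G) -> \bar R}.

(* Nonemptiness is implicit in dividing by the (then positive) measure of
   [H n]. *)
Definition van_hove (H : nat -> set G) :=
  [/\ forall n, [/\ H n !=set0, open (H n) & precompact (H n)],
    \bigcup_n H n = [set: G] &
    forall x : G,
      (fine (mu ([set x + y | y in H n] `&` ~` H n)) / fine (mu (H n)))
        @[n --> \oo] --> (0 : R)].

(* [m] is the mean M(f); requiring a van Hove sequence makes [m] unique. *)
Definition is_mean (f : G -> R) (m : R) :=
  (exists H, van_hove H) /\
  forall H, van_hove H ->
    ((fine (mu (H n)))^-1 * Rintegral mu (H n) f) @[n --> \oo] --> m.

End almost_periodic.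

Section translation_systems.
Context {R : realType} {G : topologicalZmodType} {J : countType}.
Variables (mu : {measure set (borel G) -> \bar R})
          (muhat : {measure set (borel (dual R G)) -> \bar R})
          (F : (G -> R[i]) -> dual R G -> R[i]) (E : set (dual R G))
          (Gam : J -> zmodClosed G) (g : J -> G -> R[i]).

Definition ti_index : set (J * G) := [set p | p.2 \in Gam p.1].

Definition ti_system (p : J * G) : G -> R[i] := translate p.2 (g p.1).

(* [ti_energy_j f j] and [ti_energy f] are w_{f;g,j} and w_{f;g}. *)
Definition ti_energy_j (f : G -> R[i]) (j : J) (x : G) : \bar R :=
  \esum_(c in [set` Gam j])
    (normc (inner mu (translate x f) (translate c (g j))) ^+ 2)%:E.

Definition ti_energy (f : G -> R[i]) (x : G) : \bar R :=
  \esum_(j in [set: J]) ti_energy_j f j x.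

Definition UCP1 := forall f, test_fun mu muhat F E f ->
  [/\ forall x, ti_energy f x \is a fin_num,
      almost_periodic (fun x => fine (ti_energy f x) : R^o) &
      forall eps : R, 0 < eps ->
        exists J1 : {fset J}, forall J2 : {fset J}, (J1 `<=` J2)%fset ->
        exists2 m : R,
          is_mean mu
            (fun x => `|fine (ti_energy f x) -
                        \sum_(j <- J2) fine (ti_energy_j f j x)|) m &
          m < eps].

End translation_systems.

(* Main.v *)
Require Import Defs.
From HB Require Import structures.
From mathcomp Require Import all_boot all_order all_algebra finmap.
From mathcomp Require Import ring lra.
From mathcomp Require Import all_classical all_reals all_analysis.
From mathcomp Require Import measurable_realfun.
From mathcomp Require Import complex.

(** The frame inequality is averaged over all translates of a test function.

    Let [K] be a compact set of characters off the blind spot and let [f] be the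
    function whose transform is the indicator of [K]; its squared norm is [muhat
    K]. Since translates of [f] have the same norm, [A * muhat K] is at most the
    energy [w_{f;g}] ([ti_energy]) at every point of the group, hence at most
    its mean. By the convergence property this mean is, up to an arbitrarily
    small error, the sum of the means of finitely many [w_{f;g,j}]. So it is
    enough to bound the mean of [w_{f;g,j}] by [B / covol (Gam j)]; summing over
    [j] gives [A * muhat K] at most [B] times the bandwidth, and inner
    regularity extends this from [K] to the dual group, as [E] is null
    ([window_bound]).

    The function [w_{f;g,j}] is the sum of the translates by [Gam j] of the
    squared modulus of [u x = <T_x f, g_j>]. Two facts bound its mean. Firstly
    ([orbit_energy]), the square integral of [u] is at most [||g_j||^2]: on the
    Fourier side [u] is the Fourier integral of the transform of [g_j] cut off
    to [K]. A duality argument through Fubini's theorem reduces the bound to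
    Plancherel's identity on [G]. Moreover [||g_j||^2 <= B], by the upper frame
    inequality at [g_j]. Secondly ([periodization_mean]), averaging a bounded
    periodic function over a large set of a van Hove sequence changes little if
    the set is translated by [t], and integrating over [t] in a fundamental
    domain [P] unfolds the periodization: as the translates of [P] by the
    lattice are disjoint, the mean is at most the integral of [|u|^2] over the
    group, divided by [mu P]. If [mu P] is infinite, subsets of [P] of large
    finite measure, whose translates are disjoint too, show that the mean is 0.

    If [G] is not discrete, the total mass of the dual is infinite
    ([finite_dual_discrete]): the transform of the indicator of an open set [U]
    is bounded by [mu U] while its square integral is [mu U], so a finite dual
    would bound the measures of the neighbourhoods of 0 from below. *)

Set Implicit Arguments.
Unset Strict Implicit.
Unset Printing Implicit Defensive.

Import Order.TTheory GRing.Theory Num.Theory.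
Import numFieldNormedType.Exports.

Local Open Scope classical_set_scope.
Local Open Scope ring_scope.

(** * Complex square-integrable functions *)

Section complex_L2.
Context {R : realType} {d : measure_display} {T : measurableType d}.
Variable m : {measure set T -> \bar R}.
Implicit Types f g h : T -> R[i].
Import ComplexField.Normc.

Local Notation Re := complex.Re.
Local Notation Im := complex.Im.
Local Notation "x %:C" := (real_complex _ x).

Lemma normc_sqr (z : R[i]) : normc z ^+ 2 = Re z ^+ 2 + Im z ^+ 2.
Proof. by case: z => a b; rewrite /= sqr_sqrtr// addr_ge0 ?sqr_ge0. Qed.

Lemma normc_ge0 (z : R[i]) : 0 <= normc z.
Proof. by case: z => a b /=; exact: sqrtr_ge0. Qed.

Lemma Re_mul (a b : R[i]) : Re (a * b) = Re a * Re b - Im a * Im b.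
Proof. by case: a; case: b. Qed.
Lemma Im_mul (a b : R[i]) : Im (a * b) = Re a * Im b + Im a * Re b.
Proof. by case: a => a1 a2; case: b. Qed.
Lemma Re_conj (a : R[i]) : Re (conjc a) = Re a.
Proof. by case: a. Qed.
Lemma Im_conj (a : R[i]) : Im (conjc a) = - Im a.
Proof. by case: a. Qed.

Lemma normc_conj (a : R[i]) : normc (conjc a) = normc a.
Proof. by case: a => a b /=; rewrite sqrrN. Qed.

Lemma complexP (a b : R[i]) : Re a = Re b -> Im a = Im b -> a = b.
Proof. by case: a => a1 a2; case: b => b1 b2 /= -> ->. Qed.

Lemma Re_le_normc (z : R[i]) : `|Re z| <= normc z.
Proof.
rewrite -(@ler_pXn2r _ 2)// ?nnegrE ?normc_ge0// normc_sqr.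
by rewrite real_normK ?num_real// lerDl sqr_ge0.
Qed.

Lemma Im_le_normc (z : R[i]) : `|Im z| <= normc z.
Proof.
rewrite -(@ler_pXn2r _ 2)// ?nnegrE ?normc_ge0// normc_sqr.
by rewrite real_normK ?num_real// lerDr sqr_ge0.
Qed.

Lemma cmeasurable_cst (z : R[i]) : @cmeasurable R d T (fun=> z).
Proof. by split; exact: measurable_cst. Qed.

Lemma cmeasurableD f g : cmeasurable f -> cmeasurable g ->
  cmeasurable (fun x => f x + g x).
Proof.
move=> [f1 f2] [g1 g2]; split.
- by under eq_fun do rewrite raddfD; exact: measurable_funD.
- by under eq_fun do rewrite raddfD; exact: measurable_funD.
Qed.

Lemma cmeasurableN f : cmeasurable f -> cmeasurable (fun x => - f x).
Proof.
move=> [f1 f2]; split.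
- by under eq_fun do rewrite raddfN; exact: measurableT_comp.
- by under eq_fun do rewrite raddfN; exact: measurableT_comp.
Qed.

Lemma cmeasurableB f g : cmeasurable f -> cmeasurable g ->
  cmeasurable (fun x => f x - g x).
Proof. by move=> mf mg; apply: cmeasurableD => //; exact: cmeasurableN. Qed.

Lemma cmeasurableM f g : cmeasurable f -> cmeasurable g ->
  cmeasurable (fun x => f x * g x).
Proof.
move=> [f1 f2] [g1 g2]; split.
- under eq_fun do rewrite Re_mul.
  by apply: measurable_funB; exact: measurable_funM.
- under eq_fun do rewrite Im_mul.
  by apply: measurable_funD; exact: measurable_funM.
Qed.

Lemma cmeasurable_conj f : cmeasurable f -> cmeasurable (fun x => (f x)^*).
Proof.
move=> [f1 f2]; split.
- by under eq_fun do rewrite Re_conj.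
- by under eq_fun do rewrite Im_conj; exact: measurableT_comp.
Qed.

Lemma cmeasurable_real (r : T -> R) : measurable_fun setT r ->
  cmeasurable (fun x => (r x)%:C).
Proof. by move=> mr; split => //=; exact: measurable_cst. Qed.

Lemma measurable_normc_sqr f : cmeasurable f ->
  measurable_fun setT (fun x => normc (f x) ^+ 2).
Proof.
move=> [f1 f2]; under eq_fun do rewrite normc_sqr.
by apply: measurable_funD; exact: measurable_funX.
Qed.

Lemma measurable_normc f : cmeasurable f ->
  measurable_fun setT (fun x => normc (f x)).
Proof.
move=> mf; under eq_fun do rewrite -(ger0_norm (normc_ge0 _)) -sqrtr_sqr.
apply: (measurableT_comp (f := @Num.sqrt R)); last exact: measurable_normc_sqr.
by apply: continuous_measurable_fun; exact: sqrt_continuous.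
Qed.

Lemma L1P f : L1 m f <-> m.-integrable setT (fun x => (Re (f x))%:E) /\
                      m.-integrable setT (fun x => (Im (f x))%:E).
Proof.
split=> [[[f1 f2] foo]|[f1 f2]].
  have nf : m.-integrable setT (fun x => (normc (f x))%:E).
    apply/integrableP; split.
      by apply/measurable_EFinP; exact: measurable_normc.
    by under eq_integral do rewrite gee0_abs ?lee_fin ?normc_ge0//.
  split; apply: le_integrable nf => //; try exact/measurable_EFinP.
  - by move=> x _; rewrite /= lee_fin (ger0_norm (normc_ge0 _)) Re_le_normc.
  - by move=> x _; rewrite /= lee_fin (ger0_norm (normc_ge0 _)) Im_le_normc.
have mf : cmeasurable f.
  by split; apply/measurable_EFinP; [case/integrableP: f1|case/integrableP: f2].
split=> //.
have /integrableP[_] := integrableD measurableT (integrable_abse f1) (integrable_abse f2).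
apply: le_lt_trans; apply: ge0_le_integral => //.
- by move=> x _; rewrite lee_fin normc_ge0.
- by apply/measurable_EFinP; exact: measurable_normc.
- by apply: measurableT_comp => //; case/integrableP: (integrableD measurableT (integrable_abse f1) (integrable_abse f2)).
- move=> x _; change ((normc (f x))%:E <= (`| (`|Re (f x)| + `|Im (f x)|) |%R)%:E)%E.
  rewrite lee_fin (ger0_norm (addr_ge0 (normr_ge0 _) (normr_ge0 _))).
  rewrite -(@ler_pXn2r _ 2)// ?nnegrE ?normc_ge0 ?addr_ge0// normc_sqr sqrrD.
  rewrite !real_normK ?num_real// addrAC lerDl mulrn_wge0// mulr_ge0//.
Qed.

Lemma L1_cmeas f : L1 m f -> cmeasurable f. Proof. by case. Qed.
Lemma L2_cmeas f : L2 m f -> cmeasurable f. Proof. by case. Qed.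

Lemma L1_le f (b : T -> R) : cmeasurable f ->
  m.-integrable setT (EFin \o b) -> (forall x, normc (f x) <= b x) -> L1 m f.
Proof.
move=> mf /integrableP[mb boo] fb; split=> //; apply: le_lt_trans boo.
apply: ge0_le_integral => //.
- by move=> x _; rewrite lee_fin normc_ge0.
- by apply/measurable_EFinP; exact: measurable_normc.
- exact: measurableT_comp.
- by move=> x _; rewrite /= lee_fin (le_trans (fb x))// ler_norm.
Qed.

Lemma cintegralZ (a : R[i]) f : L1 m f ->
  cintegral m (fun x => a * f x) = a * cintegral m f.
Proof.
move=> /L1P[f1 f2]; have Z r (h : T -> R) : m.-integrable setT (EFin \o h) ->
    m.-integrable setT (EFin \o (fun x => r * h x)).
  by move=> ih; rewrite (_ : _ \o _ = fun x => (r%:E * (h x)%:E)%E)//; exact: integrableZl.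
apply: complexP => /=.
- under eq_Rintegral do rewrite Re_mul.
  by rewrite RintegralB ?RintegralZl// ?Re_mul//; exact: Z.
- under eq_Rintegral do rewrite Im_mul.
  by rewrite RintegralD ?RintegralZl// ?Im_mul//; exact: Z.
Qed.

Lemma eq_cintegral f g : f =1 g -> cintegral m f = cintegral m g.
Proof. by move=> /funext ->. Qed.

Lemma ae_eq_cintegral f g : cmeasurable f -> cmeasurable g ->
  ae_eqc m f g -> cintegral m f = cintegral m g.
Proof.
move=> [f1 f2] [g1 g2] fg; congr Complex; rewrite /Rintegral.
- congr fine; apply: ae_eq_integral => //; try exact/measurable_EFinP.
  by apply: filterS fg => x /= -> .
- congr fine; apply: ae_eq_integral => //; try exact/measurable_EFinP.
  by apply: filterS fg => x /= -> .
Qed.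

Lemma L2_integrable f : L2 m f ->
  m.-integrable setT (fun x => (normc (f x) ^+ 2)%:E).
Proof.
move=> [mf foo]; apply/integrableP; split.
  by apply/measurable_EFinP; exact: measurable_normc_sqr.
by under eq_integral do rewrite gee0_abs ?lee_fin ?exprn_ge0 ?normc_ge0//.
Qed.

Lemma l2norm2_ge0 f : (0 <= l2norm2 m f)%E.
Proof. by apply: integral_ge0 => x _; rewrite lee_fin exprn_ge0 ?normc_ge0. Qed.

Lemma L2_fin_num f : L2 m f -> l2norm2 m f \is a fin_num.
Proof. by move=> [_ ?]; rewrite ge0_fin_numE// l2norm2_ge0. Qed.

Lemma L2_le f (b : T -> R) : cmeasurable f ->
  m.-integrable setT (EFin \o b) -> (forall x, normc (f x) ^+ 2 <= b x) ->
  L2 m f.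
Proof.
move=> mf /integrableP[mb boo] fb; split=> //; apply: le_lt_trans boo.
apply: ge0_le_integral => //.
- by move=> x _; rewrite lee_fin exprn_ge0 ?normc_ge0.
- by apply/measurable_EFinP; exact: measurable_normc_sqr.
- exact: measurableT_comp.
- by move=> x _; rewrite /= lee_fin (le_trans (fb x))// ler_norm.
Qed.

Lemma eq_l2norm2 f g : (forall x, normc (f x) = normc (g x)) ->
  l2norm2 m f = l2norm2 m g.
Proof. by move=> fg; apply: eq_integral => x _; rewrite fg. Qed.

Lemma ae_eq_l2norm2 f g : cmeasurable f -> cmeasurable g ->
  ae_eqc m f g -> l2norm2 m f = l2norm2 m g.
Proof.
move=> mf mg fg; apply: ae_eq_integral => //.
- by apply/measurable_EFinP; exact: measurable_normc_sqr.
- by apply/measurable_EFinP; exact: measurable_normc_sqr.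
- by apply: filterS fg => x /= -> .
Qed.

(** The two sides differ by the squared modulus of [a - b]. *)
Lemma normc_sqrD_le (a b : R[i]) :
  normc (a + b) ^+ 2 <= 2 * normc a ^+ 2 + 2 * normc b ^+ 2.
Proof.
rewrite !normc_sqr !raddfD /=; case: a b => a1 a2 [b1 b2] /=.
rewrite -subr_ge0 (_ : _ - _ = (a1 - b1) ^+ 2 + (a2 - b2) ^+ 2); last by ring.
by rewrite addr_ge0 ?sqr_ge0.
Qed.

Lemma L2D f g : L2 m f -> L2 m g -> L2 m (fun x => f x + g x).
Proof.
move=> Lf Lg; apply: (@L2_le _ (fun x => 2 * normc (f x) ^+ 2 + 2 * normc (g x) ^+ 2)).
- by apply: cmeasurableD; exact: L2_cmeas.
- rewrite [X in integrable _ _ X](_ : _ =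
    fun x => (2%:E * (normc (f x) ^+ 2)%:E + 2%:E * (normc (g x) ^+ 2)%:E)%E)//.
  by apply: integrableD => //; apply: integrableZl => //; exact: L2_integrable.
- by move=> x; exact: normc_sqrD_le.
Qed.

Lemma L2_unit f (c : T -> R[i]) : cmeasurable c -> (forall x, normc (c x) = 1) ->
  L2 m f -> L2 m (fun x => c x * f x).
Proof.
move=> mc c1 Lf; apply: L2_le (L2_integrable Lf) _.
- by apply: cmeasurableM => //; exact: L2_cmeas.
- by move=> x; rewrite normcM c1 mul1r.
Qed.

Lemma L2N f : L2 m f -> L2 m (fun x => - f x).
Proof.
move=> Lf; apply: L2_le (L2_integrable Lf) _.
- by apply: cmeasurableN; exact: L2_cmeas.
- by move=> x; rewrite normcN.
Qed.

Lemma L2B f g : L2 m f -> L2 m g -> L2 m (fun x => f x - g x).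
Proof. by move=> Lf Lg; apply: L2D => //; exact: L2N. Qed.

Lemma L2_conj f : L2 m f -> L2 m (fun x => (f x)^*).
Proof.
move=> Lf; apply: L2_le (L2_integrable Lf) _.
- by apply: cmeasurable_conj; exact: L2_cmeas.
- by move=> x; rewrite normc_conj.
Qed.

Lemma l2norm2D_le f g : L2 m f -> L2 m g ->
  (l2norm2 m (fun x => (f x + g x)%R) <= 2%:E * l2norm2 m f + 2%:E * l2norm2 m g)%E.
Proof.
move=> Lf Lg; have mf := L2_cmeas Lf; have mg := L2_cmeas Lg.
have M h : cmeasurable h -> measurable_fun setT (fun x : T => (normc (h x) ^+ 2)%:E).
  by move=> mh; apply/measurable_EFinP; exact: measurable_normc_sqr.
have P h (x : T) : (0 <= (normc (h x) ^+ 2)%:E)%E.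
  by rewrite lee_fin exprn_ge0 ?normc_ge0.
rewrite /l2norm2 -!ge0_integralZl//; [|exact: M..].
rewrite -ge0_integralD//; first last.
- by apply: measurable_funeM; exact: M.
- by move=> x _; rewrite mule_ge0.
- by apply: measurable_funeM; exact: M.
- by move=> x _; rewrite mule_ge0.
apply: ge0_le_integral => //.
- by move=> x _; rewrite lee_fin exprn_ge0 ?normc_ge0.
- by apply: (M (fun x => f x + g x)); exact: cmeasurableD.
- by apply: emeasurable_funD; apply: measurable_funeM; exact: M.
- by move=> x _; rewrite -!EFinM -EFinD lee_fin normc_sqrD_le.
Qed.

Lemma normc_mul_le (a b : R[i]) :
  2 * normc (a * b) <= normc a ^+ 2 + normc b ^+ 2.
Proof.
rewrite normcM -subr_ge0 (_ : _ - _ = (normc a - normc b) ^+ 2) ?sqr_ge0//.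
by ring.
Qed.

Lemma L2_mul f g : L2 m f -> L2 m g -> L1 m (fun x => f x * g x).
Proof.
move=> Lf Lg; apply: (@L1_le _ (fun x => normc (f x) ^+ 2 + normc (g x) ^+ 2)).
- by apply: cmeasurableM; exact: L2_cmeas.
- rewrite [X in integrable _ _ X](_ : _ =
    fun x => ((normc (f x) ^+ 2)%:E + (normc (g x) ^+ 2)%:E)%E)//.
  by apply: integrableD => //; exact: L2_integrable.
- move=> x; have := normc_mul_le (f x) (g x); have := normc_ge0 (f x * g x); lra.
Qed.

Lemma inner_L1 f g : L2 m f -> L2 m g -> L1 m (fun x => f x * (g x)^*).
Proof. by move=> Lf Lg; apply: L2_mul => //; exact: L2_conj. Qed.

Lemma inner_self f : L2 m f -> inner m f f = (fine (l2norm2 m f))%:C.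
Proof.
move=> Lf; rewrite /inner /cintegral; apply: complexP => /=.
- rewrite /Rintegral; congr fine; apply: eq_integral => x _.
  by rewrite Re_mul Re_conj Im_conj mulrN opprK normc_sqr -!expr2.
- transitivity (Rintegral m setT (fun=> 0)); last by rewrite Rintegral_cst// mul0r.
  by apply: eq_Rintegral => x _; rewrite Im_mul Re_conj Im_conj mulrN mulrC addNr.
Qed.

(** Integrating the inequality between the arithmetic and the geometric mean; it
    is weaker than the Cauchy-Schwarz inequality, but [orbit_energy_finite] can
    absorb the first term of the bound. *)
Lemma Re_inner_le f g : L2 m f -> L2 m g ->
  2 * Re (inner m f g) <= fine (l2norm2 m f) + fine (l2norm2 m g).
Proof.
move=> Lf Lg; have [If If'] := (L1P (fun x => f x * (g x)^*)).1 (inner_L1 Lf Lg).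
have F h : L2 m h -> fine (l2norm2 m h) = Rintegral m setT (fun x => normc (h x) ^+ 2) by [].
rewrite !F// -RintegralD//; [|exact: L2_integrable..].
rewrite /inner /cintegral/= -RintegralZl//.
apply: le_Rintegral => //.
- rewrite [X in integrable _ _ X](_ : _ =
    fun x => (2%:E * (Re (f x * (g x)^*))%:E)%E)//.
  exact: integrableZl.
- rewrite [X in integrable _ _ X](_ : _ =
    fun x => ((normc (f x) ^+ 2)%:E + (normc (g x) ^+ 2)%:E)%E)//.
  by apply: integrableD => //; exact: L2_integrable.
- move=> x _; have := normc_mul_le (f x) (g x)^*; rewrite normc_conj.
  have := Re_le_normc (f x * (g x)^*); have := ler_norm (Re (f x * (g x)^*)); lra.
Qed.

Lemma l2norm2_eq0 f : cmeasurable f -> l2norm2 m f = 0%E -> ae_eqc m f (fun=> 0).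
Proof.
move=> mf f0.
have : ae_eq m setT (fun x => (normc (f x) ^+ 2)%:E) (cst 0%E).
  apply/ae_eq_integral_abs => //.
    by apply/measurable_EFinP; exact: measurable_normc_sqr.
  by rewrite -[RHS]f0; apply: eq_integral => x _; rewrite gee0_abs// lee_fin exprn_ge0 ?normc_ge0.
apply: filterS => x /= /(_ Logic.I)[] /eqP.
by rewrite sqrf_eq0 => /eqP/eq0_normc.
Qed.
Lemma normc_indic (A : set T) x : normc ((\1_A x : R)%:C) = \1_A x.
Proof. by rewrite /= expr0n addr0 sqrtr_sqr ger0_norm// indicE. Qed.

Lemma L2_indic (A : set T) :
  measurable A -> (m A < +oo)%E -> L2 m (fun x => (\1_A x : R)%:C).
Proof.
move=> mA Aoo; split; first by apply: cmeasurable_real; exact: measurable_indic.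
rewrite /l2norm2; under eq_integral do rewrite normc_indic.
rewrite (_ : (fun x => _) = (fun x => (\1_A x)%:E)); last first.
  by apply/funext => x; rewrite indicE; case: (_ \in _); rewrite ?expr1n ?expr0n.
by rewrite integral_indic// setIT.
Qed.

Lemma l2norm2_indic (A : set T) :
  measurable A -> l2norm2 m (fun x => (\1_A x : R)%:C) = m A.
Proof.
move=> mA; rewrite /l2norm2; under eq_integral do rewrite normc_indic.
rewrite (_ : (fun x => _) = (fun x => (\1_A x)%:E)); last first.
  by apply/funext => x; rewrite indicE; case: (_ \in _); rewrite ?expr1n ?expr0n.
by rewrite integral_indic// setIT.
Qed.

End complex_L2.

(** * Iterated integrals of functions supported in sets of finite measure *)

Section restricted_fubini.
Context {R : realType}.
Import ComplexField.Normc.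

Local Notation Re := complex.Re.
Local Notation Im := complex.Im.
Local Notation "x %:C" := (real_complex _ x).

(** Restricting a measure to a set of finite measure is invisible to functions
    that vanish off the set.  This opens the Fubini-Tonelli theorems to a Haar
    measure on a dual group, without a proof that it is sigma-finite. *)
Lemma finite_restriction {d} {T : measurableType d}
    (m : {measure set T -> \bar R}) (D : set T) :
  measurable D -> (m D < +oo)%E ->
  exists m' : {finite_measure set T -> \bar R},
    forall f : T -> \bar R, (forall x, ~ D x -> f x = 0%E) ->
      (\int[m']_x f x = \int[m]_x f x)%E.
Proof.
move=> mD Doo.
have fin : fin_num_fun (mrestr m mD).
  move=> A mA; rewrite ge0_fin_numE//; apply: le_lt_trans Doo.
  by rewrite /mrestr le_measure// ?inE//; exact: measurableI.
pose m' : {finite_measure set T -> \bar R} :=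
  HB.pack (mrestr m mD) (Measure_isFinite.Build _ _ _ _ fin).
exists m' => f f0.
have fD : f \_ D = f.
  apply/funext => x; rewrite patchE; case: ifPn => // /negP xD.
  by rewrite f0// => Dx; apply: xD; rewrite inE.
rewrite -fD -!integral_mkcond.
by apply: eq_measure_integral => A mA AD; rewrite /= /mrestr (setIidl AD).
Qed.

Context {d1 d2 : measure_display} {T1 : measurableType d1} {T2 : measurableType d2}.
Variables (m1 : {measure set T1 -> \bar R}) (m2 : {measure set T2 -> \bar R}).
Variables (C : set T1) (K : set T2).
Hypotheses (mC : measurable C) (mK : measurable K).
Hypotheses (Coo : (m1 C < +oo)%E) (Koo : (m2 K < +oo)%E).

Lemma restricted_tonelli (f : T1 * T2 -> \bar R) :
  measurable_fun setT f -> (forall p, 0 <= f p)%E ->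
  (forall x y, ~ C x -> f (x, y) = 0%E) -> (forall x y, ~ K y -> f (x, y) = 0%E) ->
  (\int[m1]_x \int[m2]_y f (x, y) = \int[m2]_y \int[m1]_x f (x, y))%E.
Proof.
move=> mf f0 fC fK.
have [n1 n1E] := finite_restriction mC Coo.
have [n2 n2E] := finite_restriction mK Koo.
have E1 x : (\int[m2]_y f (x, y) = \int[n2]_y f (x, y))%E.
  by rewrite n2E// => y; exact: fK.
have E2 y : (\int[m1]_x f (x, y) = \int[n1]_x f (x, y))%E.
  by rewrite n1E// => x; exact: fC.
under eq_integral do rewrite E1.
under [RHS]eq_integral do rewrite E2.
rewrite -n1E; last by move=> x xC; apply: integral0_eq => y _; exact: fC.
rewrite -n2E; last by move=> x xC; apply: integral0_eq => y _; exact: fK.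
exact: (fubini_tonelli (m1 := n1) (m2 := n2)).
Qed.

Lemma restricted_tonelli_measurable (f : T1 * T2 -> \bar R) :
  measurable_fun setT f -> (forall p, 0 <= f p)%E ->
  (forall x y, ~ K y -> f (x, y) = 0%E) ->
  measurable_fun setT (fun x => \int[m2]_y f (x, y))%E.
Proof.
move=> mf f0 fK.
have [n2 n2E] := finite_restriction mK Koo.
rewrite (_ : (fun x => _) = (fun x => \int[n2]_y f (x, y))%E).
  exact: (measurable_fun_fubini_tonelli_F (m2 := n2)).
by apply/funext => x; rewrite n2E// => y; exact: fK.
Qed.

Lemma restricted_Rintegral_measurable (f : T1 * T2 -> R) :
  measurable_fun setT f -> (forall x y, ~ K y -> f (x, y) = 0) ->
  measurable_fun setT (fun x => Rintegral m2 setT (fun y => f (x, y))).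
Proof.
move=> mf fK; apply: measurableT_comp => //.
have mf' : measurable_fun setT (EFin \o f) by exact/measurable_EFinP.
rewrite (_ : (fun x => _) = (fun x => \int[m2]_y (EFin \o f)^\+ (x, y) -
    \int[m2]_y (EFin \o f)^\- (x, y))%E); last first.
  apply/funext => x; rewrite integralE; congr (_ - _)%E.
    by apply: eq_integral => y _; rewrite !funeposE.
  by apply: eq_integral => y _; rewrite !funenegE.
apply: emeasurable_funB; apply: restricted_tonelli_measurable => //.
- exact: measurable_funepos.
- by move=> x y /fK fxy; rewrite funeposE /= fxy maxxx.
- exact: measurable_funeneg.
- by move=> x y /fK fxy; rewrite funenegE /= fxy oppr0 maxxx.
Qed.

Variables (a : T1 -> R) (b : T2 -> R).
Hypotheses (ia : m1.-integrable setT (EFin \o a)) (ib : m2.-integrable setT (EFin \o b)).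
Hypotheses (b0 : forall y, 0 <= b y).

Section real.
Variable f : T1 * T2 -> R.
Hypothesis mf : measurable_fun setT f.
Hypothesis fab : forall x y, `|f (x, y)| <= a x * b y.
Hypothesis fC : forall x y, ~ C x -> f (x, y) = 0.
Hypothesis fK : forall x y, ~ K y -> f (x, y) = 0.

Lemma dominated_integrable2 x : m2.-integrable setT (fun y => (f (x, y))%:E).
Proof.
apply: (le_integrable measurableT _ _ (integrableZl measurableT (a x) ib)).
- by apply/measurable_EFinP; apply: measurableT_comp => //; exact: measurable_pair1.
- by move=> y _; rewrite /= lee_fin (le_trans (fab x y))// ler_norm.
Qed.

Lemma restricted_fubini :
  Rintegral m1 setT (fun x => Rintegral m2 setT (fun y => f (x, y))) =
  Rintegral m2 setT (fun y => Rintegral m1 setT (fun x => f (x, y))).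
Proof.
have [n1 n1E] := finite_restriction mC Coo.
have [n2 n2E] := finite_restriction mK Koo.
have i1 y : m1.-integrable setT (fun x => (f (x, y))%:E).
  apply: (le_integrable measurableT _ _ (integrableZl measurableT (b y) ia)).
  - by apply/measurable_EFinP; apply: measurableT_comp => //; exact: measurable_pair2.
  - by move=> x _; rewrite /= lee_fin (le_trans (fab x y))// mulrC ler_norm.
have i2 := dominated_integrable2.
rewrite /Rintegral; congr fine.
under eq_integral do rewrite fineK ?integrable_fin_num//.
under [RHS]eq_integral do rewrite fineK ?integrable_fin_num//.
have fC' x y : ~ C x -> (f (x, y))%:E = 0%E by move=> /fC ->.
have fK' x y : ~ K y -> (f (x, y))%:E = 0%E by move=> /fK ->.
have E1 x : (\int[m2]_y (f (x, y))%:E = \int[n2]_y (f (x, y))%:E)%E.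
  by rewrite n2E// => y; exact: fK'.
have E2 y : (\int[m1]_x (f (x, y))%:E = \int[n1]_x (f (x, y))%:E)%E.
  by rewrite n1E// => x; exact: fC'.
under eq_integral do rewrite E1.
under [RHS]eq_integral do rewrite E2.
rewrite -n1E; last by move=> x xC; apply: integral0_eq => y _; exact: fC'.
rewrite -n2E; last by move=> x xC; apply: integral0_eq => y _; exact: fK'.
apply: (@Fubini _ _ _ _ _ n1 n2 (EFin \o f)).
apply/integrable12ltyP; first exact/measurable_EFinP.
have E3 x : (\int[n2]_y `|(f (x, y))%:E| = \int[m2]_y `|(f (x, y))%:E|)%E.
  by rewrite n2E// => y /fK' ->; rewrite abse0.
under eq_integral do rewrite E3.
rewrite n1E; last first.
  by move=> x xC; apply: integral0_eq => y _; rewrite fC'// abse0.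
have a0 x : (0 <= `|(a x)%:E|)%E by [].
apply: (@le_lt_trans _ _ (\int[m1]_x (`|(a x)%:E| * \int[m2]_y (b y)%:E)))%E.
  apply: ge0_le_integral => //.
  - by move=> x _; exact: integral_ge0.
  - apply: (restricted_tonelli_measurable (f := fun p => `|(f p)%:E|%E)) => //.
      by apply: measurableT_comp => //; exact/measurable_EFinP.
    by move=> x y /fK' ->; rewrite abse0.
  - apply: emeasurable_funM => //.
    by apply: measurableT_comp => //; case/integrableP : ia.
  - move=> x _; rewrite -ge0_integralZl//; last 2 first.
    + by case/integrableP : ib.
    + by move=> y _; rewrite lee_fin.
    apply: ge0_le_integral => //.
    + apply: measurableT_comp => //; apply/measurable_EFinP.
      by apply: measurableT_comp => //; exact: measurable_pair1.
    + by apply: measurable_funeM; case/integrableP : ib.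
    + move=> y _; rewrite /= lee_fin (le_trans (fab x y))//.
      by rewrite ler_wpM2r// ler_norm.
rewrite ge0_integralZr//; last 2 first.
- by apply: measurableT_comp => //; case/integrableP : ia.
- by apply: integral_ge0 => y _; rewrite lee_fin.
apply: lte_mul_pinfty => //.
- exact: integral_ge0.
- rewrite ge0_fin_numE; first by case/integrableP : ia.
  exact: integral_ge0.
- case/integrableP : ib => _; under eq_integral do rewrite gee0_abs ?lee_fin//.
  by [].
Qed.
End real.

Lemma restricted_cfubini (k : T1 * T2 -> R[i]) : cmeasurable k ->
  (forall x y, normc (k (x, y)) <= a x * b y) ->
  (forall x y, ~ C x -> k (x, y) = 0) -> (forall x y, ~ K y -> k (x, y) = 0) ->
  cintegral m1 (fun x => cintegral m2 (fun y => k (x, y))) =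
  cintegral m2 (fun y => cintegral m1 (fun x => k (x, y))).
Proof.
move=> [mk1 mk2] kab kC kK; apply: complexP => /=.
- apply: (restricted_fubini (f := fun p => Re (k p))) => //.
  + by move=> x y; rewrite (le_trans (Re_le_normc _)).
  + by move=> x y /kC ->.
  + by move=> x y /kK ->.
- apply: (restricted_fubini (f := fun p => Im (k p))) => //.
  + by move=> x y; rewrite (le_trans (Im_le_normc _)).
  + by move=> x y /kC ->.
  + by move=> x y /kK ->.
Qed.
End restricted_fubini.

(** * Borel sets of products and joint measurability of characters *)

Section borel_products.

Lemma countable_base (X : topologicalType) : @second_countable X ->
  exists b : nat -> set X, (forall n, open (b n)) /\
    forall x A, nbhs x A -> exists2 n, b n x & b n `<=` A.
Proof.
move=> [B cB [Bo Bn]].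
have /pfcard_geP[B0|[e]] := cB.
  exists (fun=> set0); split=> [n|x A xA]; first exact: open0.
  by have [V [/=]] := Bn x A xA; rewrite B0.
exists e; split=> [n|x A xA]; first by apply: Bo; apply: (@funS _ _ _ _ e).
have [V [/= BV Vx] VA] := Bn x A xA.
have [n _ eV] := @surj _ _ _ _ e V BV.
by exists n; rewrite eV.
Qed.

Lemma open_borel (X : PreTopologicalZmodule.type) (A : set X) : open A ->
  measurable (A : set (borel X)).
Proof. exact: sub_sigma_algebra. Qed.

Lemma closed_borel (X : PreTopologicalZmodule.type) (A : set X) : closed A ->
  measurable (A : set (borel X)).
Proof. by move=> cA; rewrite -[A]setCK; apply: measurableC; apply: open_borel; exact: closed_openC. Qed.

Lemma measurable_fun_borel d (T : measurableType d) (X : PreTopologicalZmodule.type)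
    (f : T -> borel X) :
  (forall A : set X, open A -> measurable (f @^-1` A)) -> measurable_fun setT f.
Proof.
move=> fm; apply: (@measurability _ _ T (borel X) setT f (@open X) erefl).
by move=> _ [A oA <-]; rewrite setTI; exact: fm.
Qed.

Lemma measurable_fun_openR d (T : measurableType d) (R : realType) (f : T -> R) :
  (forall A : set R, open A -> measurable (f @^-1` A)) -> measurable_fun setT f.
Proof.
move=> fm; apply: (measurability _ (RGenOpens.measurableE R)).
by move=> _ [A [a [b ->]] <-]; rewrite setTI; apply: fm; exact: interval_open.
Qed.

(** A countable base of one factor is enough, because an open subset of the
    product is the union of the rectangles whose first side is in that base and
    whose second side is the largest open set that fits. *)
Lemma open_prod_borel (X Y : PreTopologicalZmodule.type) (W : set (X * Y)) :
  @second_countable X -> open W -> measurable (W : set (borel X * borel Y)).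
Proof.
move=> /countable_base[b [bo bn]] oW.
pose V n : set Y := interior [set y | forall x, b n x -> W (x, y)].
have -> : W = \bigcup_n (b n `*` V n).
  apply/seteqP; split=> [[x y] Wxy|[x y] [n _ [/= bx]]]; last first.
    by move=> /interior_subset /(_ _ bx).
  have /= [[A B] /= [xA yB] AB] : nbhs (x, y) W by exact: open_nbhs_nbhs.
  have [n bnx bnA] := bn x A xA.
  exists n => //; split => //=; rewrite /V /interior /=.
  by apply: filterS yB => y' By' x' /bnA Ax'; apply: AB.
apply: bigcup_measurable => n _; apply: measurableX; apply: open_borel => //.
exact: open_interior.
Qed.
End borel_products.

Section complex_topology.
Context {R : realType}.
Import ComplexField.Normc.


Lemma open_normc_nbhs (z : R[i]) (P : set R[i]) (e : R) : 0 < e ->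
  (forall w, normc (z - w) < e -> P w) -> nbhs z P.
Proof.
move=> e0 zP; apply/nbhs_ballP; exists (real_complex _ e) => /=.
  by rewrite ltcR.
by move=> w zw; apply: zP; rewrite -ltcR; exact: zw.
Qed.

Lemma open_Re_preimage (A : set R) : open A -> open ((@complex.Re R) @^-1` A).
Proof.
move=> oA; rewrite openE => z /= Az.
have /nbhs_ballP[e e0 eA] : nbhs (complex.Re z) A by exact: open_nbhs_nbhs.
apply: (open_normc_nbhs e0) => w zw; apply: eA; rewrite /ball /=.
by rewrite -raddfB (le_lt_trans (Re_le_normc _)).
Qed.

Lemma open_Im_preimage (A : set R) : open A -> open ((@complex.Im R) @^-1` A).
Proof.
move=> oA; rewrite openE => z /= Az.
have /nbhs_ballP[e e0 eA] : nbhs (complex.Im z) A by exact: open_nbhs_nbhs.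
apply: (open_normc_nbhs e0) => w zw; apply: eA; rewrite /ball /=.
by rewrite -raddfB (le_lt_trans (Im_le_normc _)).
Qed.
End complex_topology.

Section characters.
Context {R : realType} {G : topologicalZmodType}.
Hypothesis lcG : locally_compact [set: G].
Import ComplexField.Normc.

Section part.
(** To be instantiated with the real part and with the imaginary part. *)
Variable p : R[i] -> R.
Hypothesis op : forall A : set R, open A -> open (p @^-1` A).

Lemma char_part_continuous (w : dual R G) : continuous (fun x => p (w x)).
Proof.
apply/continuousP => A oA.
have /continuousP/(_ _ (op oA)) := @char_continuous _ _ w.
exact.
Qed.

(** Joint continuity is what local compactness gives: a point has a compact
    neighbourhood on which a given character stays inside a given open set, and
    this condition is open in the compact-open topology. *)
Lemma char_part_open (A : set R) : open A ->
  open [set q : G * dual R G | A (p (q.2 q.1))].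
Proof.
move=> oA; rewrite openE => -[x w] /= Axw.
have nA : nbhs (p (w x)) A by exact: open_nbhs_nbhs.
have [B nB BA] := @uniform_regular R (p (w x)) A nA.
have [U nU [cU clU]] := lcG (x := x) Logic.I.
rewrite withinET in nU.
pose V := U `&` (fun y => p (w y)) @^-1` (closure B).
have cV : compact V.
  apply: (subclosed_compact _ cU); last by move=> y [].
  apply: closedI => //; apply: closed_comp; last exact: closed_closure.
  by move=> y _; exact: (@char_part_continuous w y).
have nV : nbhs x V.
  apply: filterI => //; have := char_part_continuous (w := w) (x := x).
  by apply; apply: filterS nB; exact: subset_closure.
pose N := [set v : dual R G | [set v y | y in V] `<=` p @^-1` A].
have nN : nbhs w N.
  apply: open_nbhs_nbhs; split; last first.
    by move=> _ [y [_ /BA ?] <-].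
  have oV := @compact_open_open G R[i] V _ cV (op oA).
  have /continuousP/(_ _ oV) :=
    @initial_continuous _ {compact-open, G -> R[i]} (@char_fun R G).
  exact.
exists (V, N) => //= -[y v] [/= Vy Nv]; apply: (Nv (v y)).
by exists y.
Qed.
End part.
End characters.

Section character_measurability.
Context {R : realType} {G : topologicalZmodType}.
Hypotheses (lcG : locally_compact [set: G]) (scG : @second_countable G).

Lemma char_measurable2 :
  @cmeasurable R _ _ (fun q : borel G * borel (dual R G) => (q.2 : dual R G) q.1).
Proof.
split; apply: measurable_fun_openR => A oA; apply: (open_prod_borel scG).
- exact: (char_part_open lcG open_Re_preimage oA).
- exact: (char_part_open lcG open_Im_preimage oA).
Qed.

Lemma char_measurable (w : dual R G) : @cmeasurable R _ (borel G) w.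
Proof.
have [m1 m2] := char_measurable2.
by split; [exact: (measurable_fun_pair1 (w : borel _) m1)|
           exact: (measurable_fun_pair1 (w : borel _) m2)].
Qed.

Lemma char_eval_measurable (x : G) :
  @cmeasurable R _ (borel (dual R G)) (fun w : dual R G => w x).
Proof.
have [m1 m2] := char_measurable2.
by split; [exact: (measurable_fun_pair2 (x : borel G) m1)|
           exact: (measurable_fun_pair2 (x : borel G) m2)].
Qed.

(** Distinct characters differ at some point, hence so do the real or imaginary
    parts of their values there, and these depend continuously on the character. *)
Lemma hausdorff_dual : hausdorff_space (dual R G).
Proof.
move=> a b ab; apply: char_eq => x.
have part (p : R[i] -> R) : (forall A : set R, open A -> open (p @^-1` A)) ->
    p (a x) = p (b x).
  move=> op; apply: (@Rhausdorff R) => A B; rewrite !nbhsE /=.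
  move=> [A' [oA' aA'] AA'] [B' [oB' bB'] BB'].
  have nN (c : dual R G) C : open C -> C (p (c x)) -> nbhs c [set v | C (p (v x))].
    move=> oC Cc; have : nbhs (x, c) [set q : G * dual R G | C (p (q.2 q.1))].
      by apply: open_nbhs_nbhs; split => //; exact: (char_part_open lcG op oC).
    by move=> -[[P Q] /= [xP cQ] PQ]; apply: filterS cQ => v Qv; apply: (PQ (x, v)); split => //; exact: nbhs_singleton.
  have [v [/= Av Bv]] := ab _ _ (nN a A' oA' aA') (nN b B' oB' bB').
  by exists (p (v x)); split; [exact: AA'|exact: BB'].
by apply: complexP; apply: part; [exact: open_Re_preimage|exact: open_Im_preimage].
Qed.
End character_measurability.

(** * Haar measures *)

Section haar_theory.
Context {R : realType} {G : topologicalZmodType}.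
Hypotheses (lcG : locally_compact [set: G]) (scG : @second_countable G).
Variables (mu : {measure set (borel G) -> \bar R}) (haar_mu : haar_measure mu).

Lemma measurable_sub2 : measurable_fun setT (fun q : borel G * borel G => q.1 - q.2 : borel G).
Proof.
apply: measurable_fun_borel => A oA; apply: (open_prod_borel scG).
by have /continuousP/(_ A oA) := @sub_continuous G.
Qed.

Lemma measurable_add2 : measurable_fun setT (fun q : borel G * borel G => q.1 + q.2 : borel G).
Proof.
apply: measurable_fun_borel => A oA; apply: (open_prod_borel scG).
by have /continuousP/(_ A oA) := @add_continuous G.
Qed.

Lemma measurable_translation (x : G) : measurable_fun setT (fun y : borel G => y - x : borel G).
Proof. exact: (measurable_fun_pair1 (x : borel G) measurable_sub2). Qed.

Lemma haar_translation (x : G) (A : set (borel G)) : measurable A ->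
  mu ((fun y => y - x) @^-1` A) = mu A.
Proof.
move=> mA; rewrite -[RHS](haar_shift haar_mu x mA); congr (mu _).
apply/seteqP; split=> [y /= Ay|_ [y Ay <-]]; first by exists (y - x); rewrite // addrC subrK.
by rewrite /= addrC addKr.
Qed.

Lemma integral_translation (x : G) (f : borel G -> \bar R) :
  measurable_fun setT f -> (forall y, 0 <= f y)%E ->
  (\int[mu]_y f (y - x)%R = \int[mu]_y f y)%E.
Proof.
move=> mf f0; have mt := measurable_translation x.
rewrite -[RHS](@eq_measure_integral _ _ _ _ mu (pushforward mu (fun y : borel G => y - x : borel G))).
  by rewrite (ge0_integral_pushforward mt)// => y _; exact: f0.
by move=> A mA _; exact: haar_translation.
Qed.

Lemma translation_continuous (c : G) : continuous (fun y : G => y - c).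
Proof.
move=> y; apply: (@continuous_comp G (G * G)%type G (fun y => (y, c)) (fun q => q.1 - q.2)).
  by apply: cvg_pair => /=; [exact: cvg_id|exact: cvg_cst].
exact: sub_continuous.
Qed.

(** If [U] were null, every point would have a null neighbourhood in a countable
    base, and the whole group would be null. *)
Lemma haar_open_neq0 (U : set G) : open U -> U !=set0 -> mu U != 0%E.
Proof.
move=> oU [u Uu]; apply/eqP => U0; have /eqP := haar_neq0 haar_mu; apply.
have [b [bo bn]] := countable_base scG.
pose N n : set (borel G) := if mu (b n) == 0%E then b n else set0.
have mN n : measurable (N n) by rewrite /N; case: ifP => // _; exact: open_borel.
have N0 n : mu (N n) = 0%E by rewrite /N; case: eqP.
have -> : [set: G] = \bigcup_n N n.
  apply/seteqP; split=> // x _.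
  pose V : set G := (fun y => y - (x - u)) @^-1` U.
  have oV : open V.
    by have /continuousP/(_ U oU) := @translation_continuous (x - u).
  have Vx : V x by rewrite /V /= opprB addrCA subrr addr0.
  have [n bx bV] := bn x V (open_nbhs_nbhs (conj oV Vx)).
  exists n => //; rewrite /N ifT//; apply/eqP; apply/eqP; rewrite -measure_le0.
  have <- : mu V = 0%E by rewrite haar_translation//; exact: open_borel.
  by apply: le_measure => //; rewrite inE; exact: open_borel.
apply/eqP; rewrite -measure_le0.
apply: le_trans (measure_sigma_subadditive _ _ _ (@subset_refl _ _)) _ => //.
  exact: bigcup_measurable.
by rewrite eseries0// => n _ _; exact: N0.
Qed.

Lemma haar_sigma_finite : sigma_finite setT mu.
Proof.
have [b [bo bn]] := countable_base scG.
exists (fun n => if (mu (b n) < +oo)%E then b n else set0).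
  apply/seteqP; split=> // x _.
  have [U nU [cU clU]] := lcG (x := x) Logic.I; rewrite withinET in nU.
  have [n bx bU] := bn x U nU.
  exists n => //; rewrite ifT//; apply: le_lt_trans (haar_compact haar_mu cU).
  apply: le_measure => //; rewrite inE; [exact: open_borel|exact: closed_borel].
move=> n; case: ifPn => [boo|_]; split => //; last by rewrite measure0.
exact: open_borel.
Qed.

Lemma haar_exhaustion : exists C : nat -> set (borel G),
  [/\ forall n, measurable (C n), forall n, (mu (C n) < +oo)%E,
      nondecreasing_seq C & \bigcup_n C n = setT].
Proof.
have [S S1 S2] := haar_sigma_finite.
exists (fun n => \big[setU/set0]_(i < n) S i); split.
- by move=> n; apply: bigsetU_measurable => i _; have [] := S2 i.
- move=> n; elim: n => [|n IH]; first by rewrite big_ord0 measure0.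
  have mB : measurable (\big[setU/set0]_(i < n) S i).
    by apply: bigsetU_measurable => i _; have [] := S2 i.
  have [mS Soo] := S2 n.
  by rewrite big_ord_recr/=; apply: le_lt_trans (measureU2 mu mB mS) _; rewrite lte_add_pinfty.
- by move=> m n mn; apply/subsetPset; apply: subset_bigsetU.
- apply/seteqP; split=> // x _; have : [set: borel G] x by [].
  rewrite S1 => -[n _ Snx]; exists n.+1 => //.
  by rewrite big_ord_recr; right.
Qed.
End haar_theory.

(** * The Plancherel transform of a translate *)

Section fourier_translation.
Context {R : realType} {G : topologicalZmodType}.
Hypotheses (lcG : locally_compact [set: G]) (scG : @second_countable G).
Variables (mu : {measure set (borel G) -> \bar R}) (haar_mu : haar_measure mu).
Variables (muhat : {measure set (borel (dual R G)) -> \bar R}).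
Variables (F : (G -> R[i]) -> dual R G -> R[i])
          (plancherelF : fourier_plancherel mu muhat F).
Import ComplexField.Normc.

Local Notation Re := complex.Re.
Local Notation Im := complex.Im.
Local Notation "x %:C" := (real_complex _ x).
Implicit Types f g : G -> R[i].

Lemma cmeasurable_translate x f : @cmeasurable R _ (borel G) f ->
  @cmeasurable R _ (borel G) (translate x f).
Proof.
have mt := measurable_translation scG x.
by move=> [f1 f2]; split;
  [exact: (measurableT_comp f1 mt)|exact: (measurableT_comp f2 mt)].
Qed.

Lemma l2norm2_translate x f : @cmeasurable R _ (borel G) f ->
  l2norm2 mu (translate x f) = l2norm2 mu f.
Proof.
move=> mf; apply: (integral_translation scG haar_mu x (f := fun y => (normc (f y) ^+ 2)%:E)).
  by apply/measurable_EFinP; exact: measurable_normc_sqr.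
by move=> y; rewrite lee_fin exprn_ge0 ?normc_ge0.
Qed.

Lemma L2_translate x f : L2 mu f -> L2 mu (translate x f).
Proof.
move=> [mf foo]; split; first exact: cmeasurable_translate.
by rewrite l2norm2_translate.
Qed.

Lemma L1_translate x f : L1 mu f -> L1 mu (translate x f).
Proof.
move=> [mf foo]; split; first exact: cmeasurable_translate.
rewrite [ltLHS](integral_translation scG haar_mu x (f := fun y => (normc (f y))%:E))//.
  by apply/measurable_EFinP; exact: measurable_normc.
by move=> y; rewrite lee_fin normc_ge0.
Qed.

Lemma Rintegral_translate x (r : borel G -> R) : measurable_fun setT r ->
  Rintegral mu setT (fun y => r (y - x)) = Rintegral mu setT r.
Proof.
move=> mr; rewrite /Rintegral; congr fine; rewrite integralE [RHS]integralE.
have mr' : measurable_fun setT (EFin \o r) by exact/measurable_EFinP.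
congr (_ - _)%E.
- rewrite -[RHS](integral_translation scG haar_mu x (measurable_funepos mr'))//.
  by apply: eq_integral => y _; rewrite !funeposE.
- rewrite -[RHS](integral_translation scG haar_mu x (measurable_funeneg mr'))//.
  by apply: eq_integral => y _; rewrite !funenegE.
Qed.

Lemma cintegral_translate x f : @cmeasurable R _ (borel G) f ->
  cintegral mu (translate x f) = cintegral mu f.
Proof.
move=> [mf1 mf2]; apply: complexP => /=.
- exact: (Rintegral_translate x mf1).
- exact: (Rintegral_translate x mf2).
Qed.

Lemma normc_char (w : dual R G) x : normc (w x)^* = 1.
Proof. by rewrite normc_conj char_norm. Qed.

Lemma fourier_integrand_L1 f (w : dual R G) : L1 mu f -> L1 mu (fun y => f y * (w y)^*).
Proof.
move=> [mf foo]; split.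
  by apply: cmeasurableM => //; apply: cmeasurable_conj; exact: char_measurable.
by under eq_integral do rewrite normcM normc_char mulr1.
Qed.

Lemma fourier_translate x f (w : dual R G) : L1 mu f ->
  fourier mu (translate x f) w = (w x)^* * fourier mu f w.
Proof.
move=> Lf; rewrite /fourier -cintegralZ; last exact: fourier_integrand_L1.
rewrite -[RHS](cintegral_translate x); last first.
  apply: cmeasurableM; first exact: cmeasurable_cst.
  exact: L1_cmeas (fourier_integrand_L1 w Lf).
apply: eq_cintegral => y; rewrite /translate mulrCA -rmorphM -charD.
by rewrite [x + _]addrC subrK.
Qed.

(** Where a square-integrable function is not small has finite measure, so this
    truncation is integrable; it approximates [f] in norm as [n] grows. *)
Definition truncation (n : nat) f (y : G) : R[i] :=
  if n.+1%:R^-1 <= normc (f y) then f y else 0.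

Lemma cmeasurable_truncation n f : @cmeasurable R _ (borel G) f ->
  @cmeasurable R _ (borel G) (truncation n f).
Proof.
move=> mf; have mn := measurable_normc mf.
have mb : measurable_fun setT (fun y : borel G => n.+1%:R^-1 <= normc (f y)).
  by apply: measurable_fun_ler => //; exact: measurable_cst.
rewrite /truncation; split.
- rewrite (_ : (fun y : borel G => _) = fun y : borel G =>
    if n.+1%:R^-1 <= normc (f y) then Re (f y) else 0).
    by apply: measurable_fun_ifT => //; case: mf.
  by apply/funext => y; case: ifP.
- rewrite (_ : (fun y : borel G => _) = fun y : borel G =>
    if n.+1%:R^-1 <= normc (f y) then Im (f y) else 0).
    by apply: measurable_fun_ifT => //; case: mf.
  by apply/funext => y; case: ifP.
Qed.

Lemma truncation_L2 n f : L2 mu f -> L2 mu (truncation n f).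
Proof.
move=> Lf; apply: (L2_le _ (L2_integrable Lf)).
  exact: cmeasurable_truncation (L2_cmeas Lf).
by move=> y; rewrite /truncation; case: ifP => // _; rewrite normc0 expr0n exprn_ge0 ?normc_ge0.
Qed.

Lemma truncation_L1 n f : L2 mu f -> L1 mu (truncation n f).
Proof.
move=> Lf; apply: (@L1_le _ _ (borel G) mu _ (fun y => n.+1%:R * normc (f y) ^+ 2)).
- exact: cmeasurable_truncation (L2_cmeas Lf).
- rewrite [X in integrable _ _ X](_ : _ = fun y => (n.+1%:R%:E * (normc (f y) ^+ 2)%:E)%E)//.
  by apply: integrableZl => //; exact: L2_integrable.
- move=> y; rewrite /truncation; case: ifPn => [|_]; last first.
    by rewrite normc0 mulr_ge0 ?exprn_ge0 ?normc_ge0.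
  rewrite -div1r ler_pdivrMr// mulrC => h.
  by rewrite expr2 mulrA ler_peMl ?normc_ge0.
Qed.

Lemma truncation_cvg f : L2 mu f ->
  l2norm2 mu (fun y => f y - truncation n f y) @[n --> \oo] --> 0%E.
Proof.
move=> Lf; have mf := L2_cmeas Lf.
have := @dominated_convergence _ (borel G) R mu setT measurableT
  (fun n y => (normc (f y - truncation n f y) ^+ 2)%:E) (cst 0%E)
  (fun y => (normc (f y) ^+ 2)%:E).
case.
- move=> n; apply/measurable_EFinP; apply: measurable_normc_sqr.
  by apply: cmeasurableB => //; exact: cmeasurable_truncation.
- exact: measurable_cst.
- apply: aeW => y _.
  have [fy0|fy0] := eqVneq (normc (f y)) 0.
    apply: cvg_near_cst; near=> n; rewrite /truncation.
    by rewrite (eq0_normc fy0); case: ifP => _; rewrite subrr normc0 expr0n.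
  have fy : 0 < normc (f y) by rewrite lt_neqAle eq_sym fy0 normc_ge0.
  apply: cvg_near_cst; near=> n; rewrite /truncation ifT ?subrr ?normc0 ?expr0n//.
  by apply: ltW; near: n; exact: (near_infty_natSinv_lt (PosNum fy)).
- exact: L2_integrable.
- apply: aeW => y n _; rewrite gee0_abs ?lee_fin ?exprn_ge0 ?normc_ge0//.
  by rewrite /truncation; case: ifP => _; rewrite ?subr0// subrr normc0 expr0n exprn_ge0 ?normc_ge0.
- move=> _ _; rewrite integral_cst ?mul0e//.
Unshelve. all: by end_near. Qed.

Lemma plancherel_l2norm2 f : L2 mu f -> l2norm2 muhat (F f) = l2norm2 mu f.
Proof.
move=> Lf; have LF := plancherel_L2 plancherelF Lf.
have := plancherel_inner plancherelF Lf Lf.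
rewrite !inner_self// => -[/(congr1 (@EFin R))].
by rewrite !fineK ?L2_fin_num.
Qed.

Lemma plancherelB f g : L2 mu f -> L2 mu g ->
  ae_eqc muhat (F (fun x => f x - g x)) (fun w => F f w - F g w).
Proof.
move=> Lf Lg; have := plancherel_linear plancherelF (-1) Lg Lf.
rewrite (_ : (fun x => -1 * g x + f x) = fun x => f x - g x); last first.
  by apply/funext => x; rewrite mulN1r addrC.
by apply: filterS => w -> ; rewrite mulN1r addrC.
Qed.

(** On integrable functions this is the computation of [fourier_translate].  Both
    sides are linear and isometric in [f], and truncations are dense. *)
Lemma plancherel_translate x f : L2 mu f ->
  ae_eqc muhat (F (translate x f)) (fun w => (w x)^* * F f w).
Proof.
move=> Lf; have LF h : L2 mu h -> L2 muhat (F h) by exact: plancherel_L2.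
have LT h : L2 mu h -> L2 mu (translate x h) by exact: L2_translate.
pose e (w : dual R G) := (w x)^*.
have me : @cmeasurable R _ (borel (dual R G)) e.
  by apply: cmeasurable_conj; exact: char_eval_measurable.
have e1 w : normc (e w) = 1 by exact: normc_char.
pose D h w := F (translate x h) w - e w * F h w.
have LeF h : L2 mu h -> L2 muhat (fun w => e w * F h w) by move=> /LF; exact: L2_unit.
have LD h : L2 mu h -> L2 muhat (D h) by move=> Lh; apply: L2B; [exact/LF/LT|exact: LeF].
suff D0 : l2norm2 muhat (D f) = 0%E.
  apply: filterS (l2norm2_eq0 (L2_cmeas (LD f Lf)) D0) => w /eqP.
  by rewrite subr_eq0 => /eqP.
have bound n : (l2norm2 muhat (D f) <=
    4%:E * l2norm2 mu (fun y => (f y - truncation n f y)%R))%E.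
  have Lt := truncation_L2 n Lf; have Lft := L2B Lf Lt.
  pose h y := f y - truncation n f y.
  have aeD : ae_eqc muhat (D f) (fun w => F (translate x h) w + - (e w * F h w)).
    have := plancherelB Lf Lt.
    have := plancherelB (LT f Lf) (LT _ Lt).
    have := plancherel_fourier plancherelF (truncation_L1 n Lf) Lt.
    have := plancherel_fourier plancherelF (L1_translate x (truncation_L1 n Lf)) (LT _ Lt).
    move=> H1 H2 H3 H4.
    have H13 : ae_eqc muhat (F (translate x h))
        (fun w => F (translate x f) w - e w * fourier mu (truncation n f) w).
      apply: filterS2 H1 H3 => w E1 /= E3.
      rewrite [F _ w]E3.
      by rewrite E1 fourier_translate//; exact: truncation_L1.
    apply: filterS3 H2 H13 H4 => w E2 E13 E4.
    have E4' : F h w = F f w - F (truncation n f) w := E4.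
    by rewrite /D E13 E4' E2; ring.
  rewrite (ae_eq_l2norm2 (L2_cmeas (LD f Lf)) _ aeD); last first.
    by apply: L2_cmeas; apply: L2D; [exact/LF/LT|exact/L2N/LeF].
  apply: le_trans (l2norm2D_le (LF _ (LT _ Lft)) (L2N (LeF _ Lft))) _.
  rewrite (@eq_l2norm2 _ _ _ muhat (fun w => - (e w * F h w)) (F h)); last first.
    by move=> w; rewrite normcN normcM e1 mul1r.
  rewrite !plancherel_l2norm2//; last exact: LT.
  rewrite l2norm2_translate; last exact: (L2_cmeas Lft).
  rewrite -ge0_muleDl// -EFinD (_ : 2 + 2 = 4 :> R)//.
  by ring.
apply/eqP; rewrite eq_le l2norm2_ge0 andbT.
have c0 : (4%:E * l2norm2 mu (fun y => (f y - truncation n f y)%R))%E @[n --> \oo] --> (4%:E * 0)%E.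
  by apply: cvgeZl => //; exact: truncation_cvg.
rewrite mule0 in c0; rewrite -(cvg_lim _ c0)//.
apply: lime_ge; first by apply/cvg_ex; exists 0%E.
exact: nearW.
Qed.
End fourier_translation.

(** * Square integrability of the orbit coefficients *)

Section orbit_coefficient.
Context {R : realType} {G : topologicalZmodType}.
Hypotheses (lcG : locally_compact [set: G]) (scG : @second_countable G).
Variables (mu : {measure set (borel G) -> \bar R}) (haar_mu : haar_measure mu).
Variables (muhat : {measure set (borel (dual R G)) -> \bar R}).
Variables (F : (G -> R[i]) -> dual R G -> R[i])
          (plancherelF : fourier_plancherel mu muhat F).
Import ComplexField.Normc.

Local Notation Re := complex.Re.
Local Notation Im := complex.Im.
Local Notation "x %:C" := (real_complex _ x).

Variable K : set (borel (dual R G)).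
Hypotheses (mK : measurable K) (Koo : (muhat K < +oo)%E).
Variables (f g : G -> R[i]).
Hypotheses (Lf : L2 mu f) (Lg : L2 mu g).
Hypothesis FfK : ae_eqc muhat (F f) (fun w => (\1_K w)%:C).

Definition orbit_coefficient (x : G) : R[i] := inner mu (translate x f) g.
Local Notation u := orbit_coefficient.

Let v (w : borel (dual R G)) : R[i] := (\1_K w)%:C * (F g w)^*.
Let b (w : borel (dual R G)) : R := normc (v w).

Let LFg : L2 muhat (F g) := plancherel_L2 plancherelF Lg.

Let Lv : L1 muhat v.
Proof. by apply: inner_L1 => //; exact: L2_indic. Qed.

Let mv : cmeasurable v. Proof. exact: L1_cmeas Lv. Qed.

Let ib : muhat.-integrable setT (EFin \o b).
Proof.
apply/integrableP; split.
  by apply/measurable_EFinP; exact: measurable_normc.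
by case: Lv => _; under eq_integral do rewrite -(gee0_abs (lee_tofin (normc_ge0 _))).
Qed.

Let kernel_L1 x : L1 muhat (fun w : borel (dual R G) => ((w : dual R G) x)^* * v w).
Proof.
apply: L1_le ib _; last by move=> w; rewrite normcM normc_char mul1r.
apply: cmeasurableM => //; apply: cmeasurable_conj; exact: char_eval_measurable.
Qed.

(** The Plancherel identity turns the coefficient into the conjugate Fourier
    integral of the cut-off transform of [g]. *)
Lemma orbit_coefficientE x :
  u x = cintegral muhat (fun w : borel (dual R G) => ((w : dual R G) x)^* * v w).
Proof.
have Lt := L2_translate scG haar_mu x Lf.
rewrite /u -(plancherel_inner plancherelF Lt Lg); apply: ae_eq_cintegral.
- exact: L1_cmeas (inner_L1 (plancherel_L2 plancherelF Lt) LFg).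
- exact: L1_cmeas (kernel_L1 x).
have H := plancherel_translate lcG scG haar_mu plancherelF x Lf.
by apply: filterS2 H FfK => w -> ->; rewrite /v mulrA.
Qed.

Lemma orbit_coefficient_bounded : exists M : R, forall x, normc (u x) <= M.
Proof.
pose c := Rintegral muhat setT b; exists (c + c) => x; rewrite orbit_coefficientE.
have [i1 i2] := (L1P _ _).1 (kernel_L1 x).
have nz (z : R[i]) : normc z <= `|Re z| + `|Im z|.
  rewrite -(@ler_pXn2r _ 2)// ?nnegrE ?normc_ge0 ?addr_ge0// normc_sqr sqrrD.
  by rewrite !real_normK ?num_real// addrAC lerDl mulrn_wge0// mulr_ge0.
apply: le_trans (nz _) _; apply: lerD; rewrite /=.
- apply: le_trans (le_normr_Rintegral _ i1) _ => //.
  apply: le_Rintegral => //.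
  + by move: (integrable_norm i1).
  + by move=> w _ /=; rewrite (le_trans (Re_le_normc _))// normcM normc_char mul1r.
- apply: le_trans (le_normr_Rintegral _ i2) _ => //.
  apply: le_Rintegral => //.
  + by move: (integrable_norm i2).
  + by move=> w _ /=; rewrite (le_trans (Im_le_normc _))// normcM normc_char mul1r.
Qed.

Let mkernel : cmeasurable (fun q : borel G * borel (dual R G) => ((q.2 : dual R G) q.1)^* * v q.2).
Proof.
apply: cmeasurableM; first by apply: cmeasurable_conj; exact: char_measurable2.
have [m1 m2] := mv.
by split; [exact: (measurableT_comp m1 measurable_snd)|exact: (measurableT_comp m2 measurable_snd)].
Qed.

Let v_out w : ~ K w -> v w = 0.
Proof. by move=> Kw; rewrite /v indicE memNset// mul0r. Qed.

Lemma cmeasurable_orbit_coefficient : @cmeasurable R _ (borel G) u.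
Proof.
have [m1 m2] := mkernel; split.
- rewrite (_ : (fun x => _) = fun x : borel G => Rintegral muhat setT
     (fun w => Re (((w : dual R G) x)^* * v w))); last first.
    by apply/funext => x; rewrite orbit_coefficientE.
  apply: (restricted_Rintegral_measurable mK Koo m1) => x w /v_out -> /=.
  by rewrite mulr0.
- rewrite (_ : (fun x => _) = fun x : borel G => Rintegral muhat setT
     (fun w => Im (((w : dual R G) x)^* * v w))); last first.
    by apply/funext => x; rewrite orbit_coefficientE.
  apply: (restricted_Rintegral_measurable mK Koo m2) => x w /v_out -> /=.
  by rewrite mulr0.
Qed.

(** Testing [u] against [phi], the conjugate of its own restriction to [C], gives
    the square integral of [u] over [C].  By Fubini's theorem this is also the inner
    product of the transform of [phi] with the cut-off transform of [g], whose norm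
    is at most that of [g].  As [phi] and its transform have the same norm, the mean
    inequality [Re_inner_le] gives the bound. *)
Lemma orbit_energy_finite (C : set (borel G)) : measurable C -> (mu C < +oo)%E ->
  (\int[mu]_(x in C) (normc (u x) ^+ 2)%:E <= l2norm2 mu g)%E.
Proof.
move=> mC Coo; have mu_ := cmeasurable_orbit_coefficient.
have [M uM] := orbit_coefficient_bounded.
have M0 : 0 <= M by apply: le_trans (uM 0); exact: normc_ge0.
pose phi (x : borel G) : R[i] := (\1_C x)%:C * (u x)^*.
have mphi : cmeasurable phi.
  apply: cmeasurableM; last exact: cmeasurable_conj.
  by apply: cmeasurable_real; exact: measurable_indic.
pose a (x : borel G) : R := M * \1_C x.
have phia x : normc (phi x) <= a x.
  by rewrite normcM normc_indic normc_conj mulrC ler_wpM2r// indicE.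
have ia c : mu.-integrable setT (EFin \o (fun x : borel G => c * \1_C x)).
  rewrite (_ : _ \o _ = fun x => (c%:E * (\1_C x)%:E)%E)//.
  apply: integrableZl => //; apply/integrableP; split.
    by apply/measurable_EFinP; exact: measurable_indic.
  under eq_integral do rewrite gee0_abs ?lee_fin ?indicE//.
  by rewrite integral_indic// setIT.
have L1phi : L1 mu phi by apply: L1_le (ia M) _.
have L2phi : L2 mu phi.
  apply: (L2_le mphi (ia (M ^+ 2))) => x.
  rewrite (le_trans (lerXn2r 2 _ _ (phia x))) ?nnegrE ?normc_ge0//.
    by rewrite mulr_ge0// indicE.
  by rewrite /a exprMn indicE; case: (_ \in _); rewrite ?expr1n ?expr0n.
have E1 : l2norm2 mu phi = (\int[mu]_(x in C) (normc (u x) ^+ 2)%:E)%E.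
  rewrite [RHS]integral_mkcond; apply: eq_integral => x _.
  rewrite patchE normcM normc_indic normc_conj indicE.
  by case: (_ \in _); rewrite ?mul1r// mul0r expr0n.
have LFphi := plancherel_L2 plancherelF L2phi.
pose h (w : borel (dual R G)) : R[i] := (v w)^*.
have Lh : L2 muhat h.
  apply: L2_conj; apply: L2_le (L2_integrable LFg) _ => // w.
  rewrite /v normcM normc_indic normc_conj exprMn ler_piMl ?exprn_ge0 ?normc_ge0//.
have h_le : (l2norm2 muhat h <= l2norm2 mu g)%E.
  rewrite -(plancherel_l2norm2 plancherelF Lg).
  apply: ge0_le_integral => //.
  - by move=> w _; rewrite lee_fin exprn_ge0 ?normc_ge0.
  - by apply/measurable_EFinP; apply: measurable_normc_sqr; exact: L2_cmeas Lh.
  - by apply/measurable_EFinP; apply: measurable_normc_sqr; exact: L2_cmeas LFg.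
  - move=> w _; rewrite lee_fin /h normc_conj /v normcM normc_indic normc_conj.
    by rewrite exprMn ler_piMl ?exprn_ge0 ?normc_ge0.
have E2 : inner mu phi phi = inner muhat (F phi) h.
  pose k (q : borel G * borel (dual R G)) : R[i] :=
    phi q.1 * (((q.2 : dual R G) q.1)^* * v q.2).
  transitivity (cintegral mu (fun x => cintegral muhat (fun w => k (x, w)))).
    apply: eq_cintegral => x; rewrite /k /= cintegralZ; last exact: kernel_L1.
    rewrite -orbit_coefficientE /phi indicE.
    by case: (_ \in _); rewrite ?rmorph1 ?rmorph0 ?mul1r ?mul0r// conjCK.
  rewrite (restricted_cfubini mC mK Coo Koo (ia M) ib); first last.
  - by move=> x w /v_out vw; rewrite /k /= vw !mulr0.
  - by move=> x w Cx; rewrite /k /phi /= indicE memNset// !mul0r.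
  - move=> x w; rewrite /k normcM [normc (_^* * _)]normcM normc_char mul1r.
    by rewrite ler_wpM2r ?normc_ge0// phia.
  - apply: cmeasurableM => //; have [m1 m2] := mphi.
    by split; [exact: (measurableT_comp m1 measurable_fst)|exact: (measurableT_comp m2 measurable_fst)].
  - by move=> w; exact: normc_ge0.
  apply: ae_eq_cintegral.
  - have [k1 k2] : cmeasurable k.
      apply: cmeasurableM => //; have [m1 m2] := mphi.
      by split; [exact: (measurableT_comp m1 measurable_fst)|exact: (measurableT_comp m2 measurable_fst)].
    have sw := @measurable_swap _ _ (borel (dual R G)) (borel G).
    split.
    + apply: (restricted_Rintegral_measurable mC Coo (measurableT_comp k1 sw)) => w x Cx.
      by rewrite /k /phi /= indicE memNset// !mul0r.
    + apply: (restricted_Rintegral_measurable mC Coo (measurableT_comp k2 sw)) => w x Cx.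
      by rewrite /k /phi /= indicE memNset// !mul0r.
  - exact: L1_cmeas (inner_L1 LFphi Lh).
  - have := plancherel_fourier plancherelF L1phi L2phi.
    apply: filterS => w ->; rewrite /h conjCK mulrC /fourier -cintegralZ; last exact: fourier_integrand_L1.
    apply: eq_cintegral => x; rewrite /k /=; ring.
have := Re_inner_le LFphi Lh.
rewrite -E2 inner_self//= (plancherel_l2norm2 plancherelF L2phi).
rewrite -E1 -(fineK (L2_fin_num L2phi)) -(fineK (L2_fin_num Lg)) lee_fin.
have : fine (l2norm2 muhat h) <= fine (l2norm2 mu g).
  by rewrite fine_le// ?L2_fin_num.
lra.
Qed.

Lemma orbit_energy : (\int[mu]_x (normc (u x) ^+ 2)%:E <= l2norm2 mu g)%E.
Proof.
have [C [mC Coo ndC CT]] := haar_exhaustion lcG scG haar_mu.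
have mu2 : measurable_fun setT (fun x : borel G => (normc (u x) ^+ 2)%:E).
  by apply/measurable_EFinP; apply: measurable_normc_sqr; exact: cmeasurable_orbit_coefficient.
have c : (\int[mu]_(x in C n) (normc (u x) ^+ 2)%:E)%E @[n --> \oo] -->
    (\int[mu]_x (normc (u x) ^+ 2)%:E)%E.
  rewrite -CT; apply: ge0_nondecreasing_set_cvg_integral => //.
  - by move=> n; exact: measurable_funTS.
  - by move=> n x _; rewrite lee_fin exprn_ge0 ?normc_ge0.
rewrite -(cvg_lim _ c)//; apply: lime_le; first by apply/cvg_ex; eexists; exact: c.
by apply: nearW => n; exact: orbit_energy_finite.
Qed.
End orbit_coefficient.

(** * Integrating a periodization over a packing set *)

Section countable_sums.
Context {R : realType}.

Lemma countable_enumeration (T : pointedType) (S : set T) : countable S ->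
  exists (B : set nat) (e : nat -> T), set_bij B S e.
Proof.
by move=> /countable_bijP[B]; rewrite card_eq_sym => /card_set_bijP[e eBS]; exists B, e.
Qed.

Lemma esum_enumeration (T : choiceType) (S : set T) (B : set nat) (e : nat -> T)
    (a : T -> \bar R) : set_bij B S e -> (forall c, S c -> 0 <= a c)%E ->
  \esum_(c in S) a c = (\sum_(0 <= n <oo) (if n \in B then a (e n) else 0))%E.
Proof.
move=> eBS a0; rewrite (@reindex_esum _ _ _ B S e a eBS) esum_mkcond.
rewrite nneseries_esumT// => n; case: ifPn => // /[!inE] Bn.
by apply: a0; have [+ _ _] := eBS; apply.
Qed.
End countable_sums.

Section lattice_average.
Context {R : realType} {G : topologicalZmodType}.
Hypotheses (lcG : locally_compact [set: G]) (scG : @second_countable G).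
Variables (mu : {measure set (borel G) -> \bar R}) (haar_mu : haar_measure mu).
Variables (Gam : zmodClosed G).
Hypothesis cGam : countable [set` Gam].

(** Removing from a packing set all its nontrivial translates costs only a null
    set and makes the translates disjoint, not just almost disjoint. *)
Lemma disjoint_packing (D : set (borel G)) : measurable D ->
  (forall c, c \in Gam -> c != 0 -> mu (D `&` [set c + x | x in D]) = 0%E) ->
  exists P : set (borel G), [/\ measurable P, mu P = mu D &
    forall t c c', c \in Gam -> c' \in Gam -> P (t + c) -> P (t + c') -> c = c'].
Proof.
move=> mD D0.
have mT c : measurable ([set c + x | x in D] : set (borel G)).
  rewrite (_ : [set c + x | x in D] = (fun y => y - c) @^-1` D); last first.
    apply/seteqP; split=> [_ [y Dy <-]|y /= Dy]; first by rewrite /= addrC addKr.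
    by exists (y - c); rewrite // addrC subrK.
  by rewrite -[X in measurable X]setTI; exact: (measurable_translation scG c measurableT).
have [B [e [eS einj esurj]]] := @countable_enumeration (borel G) _ cGam.
pose N_ n : set (borel G) :=
  if (n \in B) && (e n != 0) then D `&` [set e n + x | x in D] else set0.
have mN_ n : measurable (N_ n) by rewrite /N_; case: ifP => // _; exact: measurableI.
have N_0 n : mu (N_ n) = 0%E.
  by rewrite /N_; case: ifP => // /andP[/[!inE] /eS]; exact: D0.
pose N : set (borel G) := \bigcup_n N_ n.
have mN : measurable N by exact: bigcup_measurable.
have N0 : mu N = 0%E.
  apply/eqP; rewrite -measure_le0.
  apply: le_trans (measure_sigma_subadditive mu mN_ mN (@subset_refl _ _)) _.
  by rewrite eseries0.
exists (D `\` N); split.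
- exact: measurableD.
- rewrite [RHS](measureDI mu mD mN) [X in (_ + X)%E](_ : _ = 0%E) ?adde0//.
  apply/eqP; rewrite -measure_le0 -N0; apply: le_measure => //; rewrite inE//.
  exact: measurableI.
- move=> t c c' Gc Gc' [Dc Nc] [Dc' Nc']; apply/eqP/negPn/negP => cc'.
  have [n Bn en] := esurj (c - c') (rpredB Gc Gc').
  apply: Nc; exists n => //; rewrite /N_ en mem_set//= subr_eq0 cc'.
  by split=> //; exists (t + c'); rewrite // addrC -addrA [c' + _]addrC subrK.
Qed.

Variables (U : borel G -> \bar R).
Hypotheses (mU : measurable_fun setT U) (U0 : forall x, (0 <= U x)%E).

Definition periodization (x : borel G) : \bar R := \esum_(c in [set` Gam]) U (x - c).
Local Notation w := periodization.

Lemma periodization_ge0 x : (0 <= w x)%E.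
Proof. exact: esum_ge0. Qed.

Let mtr (c : G) : measurable_fun setT (fun x : borel G => U (x - c)).
Proof. exact: (measurableT_comp mU (measurable_translation scG c)). Qed.

Lemma periodizationE : exists (B : set nat) (e : nat -> borel G),
  set_bij B [set` Gam] e /\
  forall x, w x = (\sum_(0 <= n <oo) (if n \in B then U (x - e n)%R else 0))%E.
Proof.
have [B [e eB]] := @countable_enumeration (borel G) _ cGam.
by exists B, e; split=> // x; rewrite /w (esum_enumeration (a := fun c => U (x - c)) eB).
Qed.

Lemma measurable_periodization : measurable_fun setT w.
Proof.
have [B [e [_ wE]]] := periodizationE.
have -> := funext wE.
pose h n (x : borel G) := if n \in B then U (x - e n)%R else 0%E.
have h0 n x : setT x -> xpredT n -> (0 <= h n x)%E by rewrite /h; case: ifP.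
have mh n : xpredT n -> measurable_fun setT (h n).
  by move=> _; rewrite /h; case: (n \in B) => //; exact: measurable_cst.
exact: (ge0_emeasurable_sum h0 mh).
Qed.

Variable P : set (borel G).
Hypotheses (mP : measurable P) (Poo : (mu P < +oo)%E).
Hypothesis packP : forall t c c', c \in Gam -> c' \in Gam ->
  P (t + c) -> P (t + c') -> c = c'.

(** The translates of [P] by the elements of [Gam] are disjoint, so that unfolding
    the periodization integrates a translate of [U] over their union. *)
Lemma packing_integral (x : G) :
  (\int[mu]_(t in P) w (x + t)%R <= \int[mu]_t U t)%E.
Proof.
have [B [e [[eS einj _] wE]]] := periodizationE.
pose V (t : borel G) := U (x + t).
have V0 t : (0 <= V t)%E by exact: U0.
have VE : V = fun t => U (t - - x) by apply/funext => t; rewrite /V opprK addrC.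
have mV : measurable_fun setT V by rewrite VE; exact: mtr.
have mVe n : measurable_fun setT (fun t : borel G => U (x + t - e n)).
  rewrite (_ : (fun t => _) = (fun t : borel G => V (t - e n))).
    exact: (measurableT_comp mV (measurable_translation scG (e n))).
  by apply/funext => t; rewrite /V addrA.
under eq_integral do rewrite wE.
rewrite integral_nneseries//; first last.
- by move=> n t _; case: ifP.
- by move=> n; case: (n \in B) => //; exact: measurable_funTS.
pose Q n : set (borel G) := if n \in B then [set t | P (t + e n)] else set0.
have mQ n : measurable (Q n).
  rewrite /Q; case: ifP => // _.
  rewrite (_ : [set t | _] = (fun y : borel G => y - (- e n)) @^-1` P).
    by rewrite -[X in measurable X]setTI; exact: measurable_translation.
  by apply/seteqP; split=> t /=; rewrite opprK.
have QE n : (\int[mu]_(t in P) (if n \in B then U (x + t - e n)%R else 0) =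
    \int[mu]_(t in Q n) V t)%E.
  rewrite /Q; case: ifP => nB; last by rewrite integral0 integral_set0.
  rewrite [LHS]integral_mkcond [RHS]integral_mkcond.
  rewrite -[RHS](integral_translation scG haar_mu (e n)).
  - apply: eq_integral => t _; rewrite !patchE.
    rewrite (_ : (t - e n \in [set t0 | P (t0 + e n)]) = (t \in P)); last first.
      by apply/idP/idP => /[!inE] /=; rewrite subrK.
    by case: (t \in P) => //; rewrite /V addrA.
  - have mQn : measurable ([set t | P (t + e n)] : set (borel G)).
      by have := mQ n; rewrite /Q nB.
    exact: ((measurable_restrictT V mQn).1 (measurable_funTS mV)).
  - by move=> t; rewrite patchE; case: ifP => // _; exact: V0.
under eq_eseriesr do rewrite QE.
rewrite -ge0_integral_bigcup//; last 2 first.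
- exact: measurable_funTS.
- move=> n m _ _ [t []]; rewrite /Q; case: ifPn => // /[!inE] Bn Pn.
  case: ifPn => // /[!inE] Bm Pm; apply: einj; rewrite ?inE//.
  by apply: packP Pn Pm; exact: eS.
apply: (@le_trans _ _ (\int[mu]_t V t)%E).
  by apply: ge0_subset_integral => //; exact: bigcup_measurable.
by rewrite VE (integral_translation scG haar_mu (- x)).
Qed.
End lattice_average.

(** * Means of periodizations *)

Lemma sigma_finite_copy {R : realType} {d} {T : measurableType d}
    (m : {measure set T -> \bar R}) : sigma_finite setT m ->
  exists m' : {sigma_finite_measure set T -> \bar R}, forall A, m' A = m A.
Proof.
move=> sm; have sm' : sigma_finite setT (mrestr m measurableT).
  by have [S ST S2] := sm; exists S => // i; have [? ?] := S2 i; rewrite /mrestr setIT.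
exists (HB.pack_for {sigma_finite_measure set T -> \bar R} (mrestr m measurableT)
  (Measure_isSigmaFinite.Build _ _ _ _ sm')).
by move=> A; rewrite /= /mrestr setIT.
Qed.

Section packing_average.
Context {R : realType} {G : topologicalZmodType}.
Hypotheses (lcG : locally_compact [set: G]) (scG : @second_countable G).
Variables (mu : {measure set (borel G) -> \bar R}) (haar_mu : haar_measure mu).
Variables (Gam : zmodClosed G).
Hypothesis cGam : countable [set` Gam].
Variables (U : borel G -> \bar R).
Hypotheses (mU : measurable_fun setT U) (U0 : forall x, (0 <= U x)%E).
Variable P : set (borel G).
Hypotheses (mP : measurable P) (Poo : (mu P < +oo)%E).
Hypothesis packP : forall t c c', c \in Gam -> c' \in Gam ->
  P (t + c) -> P (t + c') -> c = c'.
Local Notation w := (periodization Gam U).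
Variable M : R.
Hypotheses (M0 : 0 <= M) (wM : forall x, (w x <= M%:E)%E).

(** The measure whose ratio to that of [H] tends to 0 along a van Hove sequence. *)
Definition shift_defect (H : set (borel G)) (t : G) : \bar R :=
  mu ([set - t + y | y in H] `&` ~` H).

Lemma shift_imageE (H : set (borel G)) (t : G) :
  [set - t + y | y in H] = (fun x => x - (- t)) @^-1` H.
Proof.
apply/seteqP; split=> [_ [y Hy <-]|x /= Hx]; first by rewrite /= opprK addrC addNKr.
by exists (x - - t); rewrite // opprK addrCA addNr addr0.
Qed.

Lemma measurable_shift (H : set (borel G)) (t : G) : measurable H ->
  measurable ([set - t + y | y in H] : set (borel G)).
Proof.
move=> mH; rewrite shift_imageE -[X in measurable X]setTI.
exact: (measurable_translation scG (- t) measurableT).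
Qed.

Lemma shift_defect_ge0 (H : set (borel G)) (t : G) : (0 <= shift_defect H t)%E.
Proof. exact: measure_ge0. Qed.

Lemma shift_defect_le (H : set (borel G)) (t : G) : measurable H ->
  (shift_defect H t <= mu H)%E.
Proof.
move=> mH; rewrite -[leRHS](haar_shift haar_mu (- t) mH).
have mS := measurable_shift t mH.
by apply: le_measure; rewrite ?inE//; apply: measurableI => //; exact: measurableC.
Qed.

Lemma measurable_shift_defect (H : set (borel G)) : measurable H ->
  measurable_fun setT (fun t : borel G => shift_defect H t).
Proof.
move=> mH.
have [m' m'E] := sigma_finite_copy (haar_sigma_finite lcG scG haar_mu).
pose A : set (borel G * borel G) :=
  (fun q => q.1 + q.2) @^-1` H `&` snd @^-1` (~` H).
have mA : measurable A.
  apply: measurableI; rewrite -[X in measurable X]setTI.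
    exact: (measurable_add2 scG measurableT).
  by apply: measurable_snd => //; exact: measurableC.
have := measurable_fun_xsection m' mA.
congr (measurable_fun _ _); apply/funext => t /=; rewrite m'E; congr (mu _).
rewrite shift_imageE; apply/seteqP.
by split=> x; rewrite /xsection /= in_setE /A /= opprK addrC.
Qed.

Let mw : measurable_fun setT w := measurable_periodization scG cGam mU U0.
Let w0 x : (0 <= w x)%E := periodization_ge0 Gam U0 x.

Let mwt (t : G) : measurable_fun setT (fun x : borel G => w (x + t)).
Proof.
rewrite (_ : (fun x => _) = (fun x : borel G => w (x - - t))); last first.
  by apply/funext => x; rewrite opprK.
exact: (measurableT_comp mw (measurable_translation scG (- t))).
Qed.

Lemma integral_shift_le (H : set (borel G)) (t : G) : measurable H ->
  (\int[mu]_(x in H) w x <= \int[mu]_(x in H) w (x + t)%R + M%:E * shift_defect H t)%E.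
Proof.
move=> mH; have mS := measurable_shift t mH; have mC := measurableC mH.
have -> : (\int[mu]_(x in H) w x =
    \int[mu]_(x in ([set (- t + y)%R | y in H] : set (borel G))) w (x + t)%R)%E.
  rewrite [LHS]integral_mkcond [RHS]integral_mkcond.
  rewrite -[LHS](integral_translation scG haar_mu (- t)).
  - apply: eq_integral => x _; rewrite !patchE shift_imageE.
    rewrite (_ : (x \in _ @^-1` H) = (x - - t \in H)) ?opprK//.
  - by have := (measurable_restrictT w mH).1 (measurable_funTS mw).
  - by move=> x; rewrite patchE; case: ifP.
pose S : set (borel G) := [set - t + y | y in H].
rewrite -/S -/S in mS *.
have mSH : measurable (S `&` H) by exact: measurableI.
have mSC : measurable (S `&` ~` H) by exact: measurableI.
rewrite [X in (\int[mu]_(x in X) _ <= _)%E](_ : S = (S `&` H) `|` (S `&` ~` H)); last first.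
  by rewrite -setIUr setUv setIT.
rewrite ge0_integral_setU//; first last.
- by apply/disj_setPS => x [[_ Hx] [_ /(_ Hx)]].
- exact: measurable_funTS.
apply: leeD.
  by apply: ge0_subset_integral => //; exact: measurable_funTS.
rewrite -integral_cst//.
apply: ge0_le_integral => //; exact: measurable_funTS.
Qed.

Let measurable_indicR (A : set (borel G)) : measurable A ->
  measurable_fun setT (\1_A : borel G -> R).
Proof. by move=> mA; exact: measurable_indic. Qed.

Let mint (A : set (borel G)) : measurable A -> (mu A < +oo)%E ->
  measurable_fun setT (fun x : borel G => \int[mu]_(t in A) w (x + t)%R)%E.
Proof.
move=> mA Aoo.
pose k (q : borel G * borel G) := (w (q.1 + q.2)%R * (\1_A q.2)%:E)%E.
have mk : measurable_fun setT k.
  apply: emeasurable_funM.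
    exact: (measurableT_comp mw (measurable_add2 scG)).
  apply/measurable_EFinP.
  exact: (measurableT_comp (measurable_indicR mA) measurable_snd).
have k0 q : (0 <= k q)%E by rewrite /k mule_ge0 ?lee_fin// indicE.
have kA x t : ~ A t -> k (x, t) = 0%E.
  by move=> At; rewrite /k /= indicE memNset// mule0.
have := restricted_tonelli_measurable mA Aoo mk k0 kA.
congr (measurable_fun _ _); apply/funext => x.
rewrite [RHS]integral_mkcond; apply: eq_integral => t _; rewrite patchE /k /= indicE.
by case: (t \in A); rewrite ?mule1 ?mule0.
Qed.

(** Average over [t] in [P] the comparison of the integral over [H] with that of
    the translate by [t].  After exchanging the integrals, the inner one runs over
    [P] and is bounded by [packing_integral], whatever the position in [H]. *)
Lemma packing_average (H : set (borel G)) : measurable H -> (mu H < +oo)%E ->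
  (mu P * \int[mu]_(x in H) w x <=
   mu H * \int[mu]_x U x + M%:E * \int[mu]_(t in P) shift_defect H t)%E.
Proof.
move=> mH Hoo.
have mwxt : measurable_fun setT (fun q : borel G * borel G => w (q.1 + q.2)).
  exact: (measurableT_comp mw (measurable_add2 scG)).
have d0 t : (0 <= shift_defect H t)%E by exact: shift_defect_ge0.
have md := measurable_shift_defect mH.
pose k (q : borel G * borel G) := (w (q.1 + q.2)%R * (\1_H q.1)%:E * (\1_P q.2)%:E)%E.
have mk : measurable_fun setT k.
  apply: emeasurable_funM; first apply: emeasurable_funM => //.
    apply/measurable_EFinP.
    exact: (measurableT_comp (measurable_indicR mH) measurable_fst).
  apply/measurable_EFinP.
  exact: (measurableT_comp (measurable_indicR mP) measurable_snd).
have k0 q : (0 <= k q)%E by rewrite /k !mule_ge0 ?lee_fin// indicE.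
have kH x t : ~ H x -> k (x, t) = 0%E.
  by move=> Hx; rewrite /k /= indicE memNset// mule0 mul0e.
have kP x t : ~ P t -> k (x, t) = 0%E.
  by move=> Pt; rewrite /k /= [\1_P _]indicE memNset// mule0.
have swap := restricted_tonelli mH mP Hoo Poo mk k0 kH kP.
have E1 : (\int[mu]_t \int[mu]_x k (x, t) = \int[mu]_(t in P) \int[mu]_(x in H) w (x + t)%R)%E.
  rewrite [RHS]integral_mkcond; apply: eq_integral => t _; rewrite patchE /k /=.
  rewrite [\1_P _]indicE; case: (t \in P); last first.
    by apply: integral0_eq => x _; rewrite mule0.
  rewrite [RHS]integral_mkcond; apply: eq_integral => x _; rewrite patchE mule1 indicE.
  by case: (x \in H); rewrite ?mule1 ?mule0.
have E2 : (\int[mu]_x \int[mu]_t k (x, t) = \int[mu]_(x in H) \int[mu]_(t in P) w (x + t)%R)%E.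
  rewrite [RHS]integral_mkcond; apply: eq_integral => x _; rewrite patchE /k /=.
  rewrite [\1_H _]indicE; case: (x \in H); last first.
    by apply: integral0_eq => t _; rewrite mule0 mul0e.
  rewrite [RHS]integral_mkcond; apply: eq_integral => t _; rewrite patchE mule1 indicE.
  by case: (t \in P); rewrite ?mule1 ?mule0.
have mt2 : measurable_fun setT (fun t => \int[mu]_(x in H) w (x + t)%R)%E.
  by under eq_fun do under eq_integral do rewrite addrC; exact: mint.
apply: (@le_trans _ _ (\int[mu]_(t in P) (\int[mu]_(x in H) w (x + t)%R +
    M%:E * shift_defect H t)))%E.
  rewrite muleC -(integral_cst mu mP).
  apply: ge0_le_integral; first exact: mP.
  - by move=> t _; exact: integral_ge0.
  - exact: measurable_cst.
  - apply: measurable_funTS; apply: emeasurable_funD; first exact: mt2.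
    exact: measurable_funeM.
  - by move=> t _; exact: integral_shift_le.
have Md0 t : P t -> (0 <= M%:E * shift_defect H t)%E by move=> _; rewrite mule_ge0.
have mMd : measurable_fun P (fun t => M%:E * shift_defect H t)%E.
  by apply: measurable_funTS; exact: measurable_funeM.
have i0 t : P t -> (0 <= \int[mu]_(x in H) w (x + t)%R)%E.
  by move=> _; exact: integral_ge0.
rewrite (ge0_integralD mu mP i0 (measurable_funTS mt2) Md0 mMd).
rewrite (ge0_integralZl mu mP (measurable_funTS md)); [|by move=> t _; exact: d0|exact: M0].
apply: leeD; last exact: lexx.
rewrite -E1 -swap E2 muleC -(integral_cst mu mH).
apply: ge0_le_integral; first exact: mH.
- by move=> x _; exact: integral_ge0.
- by apply: measurable_funTS; exact: mint.
- exact: measurable_cst.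
- by move=> x _; exact: (packing_integral scG haar_mu cGam mU U0 mP packP).
Qed.

End packing_average.

Section van_hove_mean.
Context {R : realType} {G : topologicalZmodType}.
Hypotheses (lcG : locally_compact [set: G]) (scG : @second_countable G).
Variables (mu : {measure set (borel G) -> \bar R}) (haar_mu : haar_measure mu).
Variables (Gam : zmodClosed G).
Hypothesis cGam : countable [set` Gam].
Variables (U : borel G -> \bar R).
Hypotheses (mU : measurable_fun setT U) (U0 : forall x, (0 <= U x)%E).
Hypothesis Uoo : (\int[mu]_x U x < +oo)%E.
Variable P : set (borel G).
Hypotheses (mP : measurable P) (Poo : (mu P < +oo)%E) (P0 : mu P != 0%E).
Hypothesis packP : forall t c c', c \in Gam -> c' \in Gam ->
  P (t + c) -> P (t + c') -> c = c'.
Local Notation w := (periodization Gam U).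
Variable M : R.
Hypotheses (M0 : 0 <= M) (wM : forall x, (w x <= M%:E)%E).

Lemma precompact_finite (H : set G) : open H -> precompact H -> (mu H < +oo)%E.
Proof.
move=> oH [V HV [cV clV]]; apply: le_lt_trans (haar_compact haar_mu cV).
by apply: le_measure; rewrite ?inE; [exact: open_borel|exact: closed_borel|exact: HV].
Qed.

(** The shift defects, divided by the measures of the sets [H n], are at most 1 and
    tend to 0 at every point, so that their integrals over [P] tend to 0 by dominated
    convergence. *)
Lemma periodization_mean (H : nat -> set G) (e : R) : van_hove mu H -> 0 < e ->
  \forall n \near \oo, (\int[mu]_(x in (H n : set (borel G))) w x <=
    ((fine (\int[mu]_x U x) / fine (mu P) + e) * fine (mu (H n)))%:E)%E.
Proof.
move=> [Hn _ Hlim] e0.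
have mH n : measurable (H n : set (borel G)) by apply: open_borel; have [] := Hn n.
have Hoo n : (mu (H n) < +oo)%E by have [_ oH pH] := Hn n; exact: precompact_finite.
pose h n := fine (mu (H n)).
have hE n : mu (H n) = (h n)%:E by rewrite fineK// ge0_fin_numE.
have h0 n : 0 <= h n by exact: fine_ge0.
have [r rE] : exists r : nat -> G -> R, forall n t, shift_defect mu (H n) t = (r n t)%:E.
  exists (fun n t => fine (shift_defect mu (H n) t)) => n t.
  rewrite fineK// ge0_fin_numE ?shift_defect_ge0//.
  exact: le_lt_trans (shift_defect_le scG haar_mu t (mH n)) (Hoo n).
have r0 n t : 0 <= r n t by rewrite -lee_fin -rE shift_defect_ge0.
have rh n t : r n t <= h n.
  by rewrite -lee_fin -hE -rE; exact: (shift_defect_le scG haar_mu t (mH n)).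
have mr n : measurable_fun setT (fun t : borel G => (r n t)%:E).
  by under eq_fun do rewrite -rE; exact: (measurable_shift_defect lcG scG haar_mu (mH n)).
pose q n t := ((r n t) / h n)%:E.
have q0 n t : (0 <= q n t)%E by rewrite lee_fin divr_ge0.
have q1 n t : (q n t <= 1%:E)%E.
  rewrite lee_fin; have := h0 n; rewrite le_eqVlt => /predU1P[<-|hn].
    by rewrite invr0 mulr0.
  by rewrite ler_pdivrMr// mul1r.
have mq n : measurable_fun setT (fun t : borel G => q n t).
  apply/measurable_EFinP; apply: measurable_realfun.measurable_funM; last exact: measurable_cst.
  by apply/measurable_EFinP; exact: mr.
have rq n t : (r n t)%:E = ((h n)%:E * q n t)%E.
  rewrite -EFinM; have [hn|hn] := eqVneq (h n) 0; last by rewrite mulrC divfK.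
  by apply/eqP; rewrite hn mul0r eqe eq_le r0 andbT -[leRHS]hn.
have qlim : (\int[mu]_(t in P) q n t)%E @[n --> \oo] --> 0%E.
  have := @dominated_convergence _ (borel G) R mu P mP q (cst 0%E) (cst 1%:E).
  case.
  - by move=> n; apply: measurable_funTS; exact: mq.
  - exact: measurable_cst.
  - apply: aeW => t _ /=; apply: cvg_EFin; first exact: nearW.
    rewrite (_ : _ \o _ = fun n => fine (shift_defect mu (H n) t) / fine (mu (H n))).
      exact: (Hlim (- t)).
    by apply/funext => n; rewrite rE.
  - apply/integrableP; split; first exact: measurable_cst.
    by under eq_integral do rewrite /= normr1; rewrite integral_cst// mul1e.
  - by apply: aeW => t n _; rewrite gee0_abs.
  - by move=> _ _; rewrite integral_cst//= mul0e.
have P0' : 0 < fine (mu P) by rewrite fine_gt0// lt_neqAle eq_sym P0 measure_ge0.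
have ME n : (M%:E * \int[mu]_(t in P) shift_defect mu (H n) t = (h n)%:E * (M%:E * \int[mu]_(t in P) q n t))%E.
  under eq_integral do rewrite rE rq.
  by rewrite ge0_integralZl//; [rewrite muleCA|exact: measurable_funTS|rewrite lee_fin].
have Mlim : (M%:E * \int[mu]_(t in P) q n t)%E @[n --> \oo] --> 0%E.
  by rewrite -(mule0 M%:E); apply: cvgeZl.
have ep : 0 < e * fine (mu P) by rewrite mulr_gt0.
have IU : (\int[mu]_x U x)%E \is a fin_num.
  by rewrite ge0_fin_numE//; exact: integral_ge0.
have ev : \forall n \near \oo, fine (M%:E * \int[mu]_(t in P) q n t)%E < e * fine (mu P).
  by have /= := cvgr_lt _ (fine_cvg Mlim); apply.
apply: filterS ev => n.
have zE : (M%:E * \int[mu]_(t in P) q n t)%E \is a fin_num.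
  have q1P : (\int[mu]_(t in P) q n t <= \int[mu]_(t in P) (cst 1%:E t))%E.
    by apply: ge0_le_integral => //; exact: measurable_funTS.
  rewrite fin_numM// ge0_fin_numE; last exact: integral_ge0.
  by apply: le_lt_trans q1P _; rewrite integral_cst// mul1e.
move=> zlt; have := packing_average lcG scG haar_mu cGam mU U0 mP Poo packP M0 wM (mH n) (Hoo n).
rewrite ME hE -(fineK IU) -(fineK zE) -[mu P]fineK ?ge0_fin_numE//.
rewrite -!EFinM -EFinD => le1.
have p1 : (0 <= ((fine (mu P))^-1)%:E)%E by rewrite lee_fin invr_ge0 ltW.
have := lee_wpmul2l p1 le1.
rewrite muleA -EFinM mulVf ?gt_eqF// mul1e => le2; apply: le_trans le2 _.
rewrite -EFinM lee_fin -mulrDr mulrCA [leRHS]mulrC ler_wpM2l//.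
rewrite mulrDr [_^-1 * fine (\int[_]_ _ _ _)]mulrC lerD2l mulrC ler_pdivrMr//.
exact: ltW.
Qed.
End van_hove_mean.

(** * Lattices and covolumes *)

Section lattice_facts.
Context {R : realType} {G : topologicalZmodType}.
Hypotheses (lcG : locally_compact [set: G]) (scG : @second_countable G).
Variables (mu : {measure set (borel G) -> \bar R}) (haar_mu : haar_measure mu).

Lemma discrete_countable (A : set G) : discrete_subset A -> countable A.
Proof.
move=> dA; have [b [bo bn]] := countable_base scG.
have H x : exists n, A x -> b n x /\ forall y, A y -> b n y -> y = x.
  have [Ax|Ax] := pselect (A x); last by exists 0%N.
  have [_ [V nV VA]] := dA x Ax; have [n bnx bnV] := bn x V nV.
  exists n => _; split=> // y Ay /bnV Vy.
  by have : (V `&` A) y by []; rewrite VA.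
have [f fP] := choice H.
apply/countable_injP; exists f => x y /[!inE] Ax Ay fxy.
have [bx _] := fP x Ax; have [_ yP] := fP y Ay.
by apply: yP => //; rewrite -fxy.
Qed.

(** A packing set of infinite measure contains packing sets of arbitrarily large
    finite measure, so the reciprocal of the covolume is approximated in every
    case. *)
Lemma finite_packing (Gam : zmodClosed G) (c : R) : 0 <= c ->
  countable [set` Gam] -> ((covol mu Gam)^-1 < c%:E)%E ->
  exists P : set (borel G), [/\ measurable P, (mu P < +oo)%E, mu P != 0%E,
    (fine (mu P))^-1 <= c &
    forall t a a', a \in Gam -> a' \in Gam -> P (t + a) -> P (t + a') -> a = a'].
Proof.
move=> c0 cGam covc.
(* The default value 0 of the covolume stands for the absence of a fundamental
   domain, and its inverse is infinite. *)
have cov0 : covol mu Gam != 0%E by apply: contraTneq covc => ->; rewrite inve0.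
have [S [mS packS _] Scov] :
    [set mu S | S in fundamental_domain mu Gam] (covol mu Gam).
  apply: getPex; apply: contrapT => noS; move/eqP: cov0; apply.
  by apply: getPN => y Sy; apply: noS; exists y.
have [P [mP PS packP]] := disjoint_packing scG cGam mS packS.
have cpos : 0 < c.
  rewrite -lte_fin; apply: le_lt_trans covc.
  by rewrite inve_ge0 -Scov measure_ge0.
have cP : ((c^-1)%:E < mu P)%E.
  move: covc; rewrite -Scov PS inve_plt ?inE ?lee_fin//.
  by rewrite inver gt_eqF.
have [C [mC Coo ndC CT]] := haar_exhaustion lcG scG haar_mu.
have mPC n : measurable (P `&` C n) by exact: measurableI.
have lim : mu (P `&` C n) @[n --> \oo] --> mu P.
  rewrite -[X in _ --> mu X]setIT -CT setI_bigcupr.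
  apply: nondecreasing_cvg_mu => //; first exact: bigcup_measurable.
  by move=> n m nm; apply/subsetPset; apply: setIS; apply/subsetPset; exact: ndC.
have [n cPn] : exists n, ((c^-1)%:E < mu (P `&` C n))%E.
  apply: contrapT => noN; move: cP; rewrite ltNge => /negP; apply.
  rewrite -(cvg_lim _ lim)//; apply: lime_le; first by apply/cvg_ex; eexists; exact: lim.
  by apply: nearW => n; rewrite leNgt; apply/negP => cn; apply: noN; exists n.
have PCoo : (mu (P `&` C n) < +oo)%E.
  by apply: le_lt_trans (Coo n); apply: le_measure; rewrite ?inE.
exists (P `&` C n); split=> //.
- by rewrite gt_eqF// (lt_trans _ cPn)// lte_fin invr_gt0.
- have pE : mu (P `&` C n) = (fine (mu (P `&` C n)))%:E by rewrite fineK// ge0_fin_numE.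
  rewrite pE lte_fin in cPn.
  have p0 : 0 < fine (mu (P `&` C n)) by apply: lt_trans cPn; rewrite invr_gt0.
  by rewrite -[leRHS]invrK lef_pV2 ?posrE ?invr_gt0// ltW.
- by move=> t a a' Ga Ga' [Pa _] [Pa' _]; exact: packP Pa Pa'.
Qed.
End lattice_facts.

(** * The energy of a translation-invariant frame *)

Lemma near_all_seq (T : eqType) (P : T -> nat -> Prop) (s : seq T) :
  (forall j, j \in s -> \forall n \near \oo, P j n) ->
  \forall n \near \oo, forall j, j \in s -> P j n.
Proof.
elim: s => [|i s IH] H; first by apply: nearW.
have Hi : \forall n \near \oo, P i n by apply: H; rewrite mem_head.
have Hs : \forall n \near \oo, forall j, j \in s -> P j n.
  by apply: IH => j js; apply: H; rewrite in_cons js orbT.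
by apply: filterS2 Hi Hs => n Pi Ps j; rewrite in_cons => /predU1P[->|/Ps].
Qed.

Section translation_frames.
Context {R : realType} {G : topologicalZmodType} {J : countType}.
Hypotheses (lcG : locally_compact [set: G]) (scG : @second_countable G).
Variables (mu : {measure set (borel G) -> \bar R}) (haar_mu : haar_measure mu).
Variables (muhat : {measure set (borel (dual R G)) -> \bar R}).
Hypothesis haar_muhat : haar_measure muhat.
Variables (F : (G -> R[i]) -> dual R G -> R[i])
          (plancherelF : fourier_plancherel mu muhat F).
Variable E : set (dual R G).
Variables (Gam : J -> zmodClosed G) (latticeGam : forall j, lattice (Gam j)).
Variables (g : J -> G -> R[i]) (L2g : forall j, L2 mu (g j)).
Variables (A B : R) (frame_g : frame mu (ti_index Gam) (ti_system g) A B).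
Import ComplexField.Normc.

Local Notation "x %:C" := (real_complex _ x).
Local Notation U f j := (fun x : borel G => (normc (orbit_coefficient mu f (g j) x) ^+ 2)%:E).

Lemma compact_dual_borel (K : set (dual R G)) : compact K ->
  measurable (K : set (borel (dual R G))).
Proof.
by move=> cK; apply: closed_borel; apply: compact_closed cK; exact: hausdorff_dual.
Qed.

Lemma plancherel_indic (K : set (dual R G)) : compact K ->
  exists f, [/\ L2 mu f, ae_eqc muhat (F f) (fun w => (\1_K w)%:C) &
    l2norm2 mu f = muhat K].
Proof.
move=> cK; have mK := compact_dual_borel cK.
have L1K := L2_indic mK (haar_compact haar_muhat cK).
have [f Lf FfK] := plancherel_surj plancherelF L1K.
exists f; split=> //.
rewrite -(plancherel_l2norm2 plancherelF Lf) -(l2norm2_indic muhat mK).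
exact: ae_eq_l2norm2 (L2_cmeas (plancherel_L2 plancherelF Lf)) (L2_cmeas L1K) FfK.
Qed.

Lemma frame_bounds_le : A <= B.
Proof.
have [K cK K0] : exists2 K : set (dual R G), compact K & muhat K != 0%E.
  apply: contrapT => noK; have /eqP := haar_neq0 haar_muhat; apply.
  rewrite (haar_inner haar_muhat openT); apply/eqP; rewrite eq_le; apply/andP; split.
    apply: ge_ereal_sup => _ [K [cK _] <-]; rewrite leNgt; apply/negP => K0.
    by apply: noK; exists K; rewrite // gt_eqF.
  apply: ereal_sup_ubound; exists set0; rewrite ?measure0//.
  by split=> //; exact: compact0.
have Koo : (muhat K < +oo)%E by exact: haar_compact.
have [f [Lf _ NE]] := plancherel_indic cK.
have [lb ub] := frame_g.2 f Lf.
have := le_trans lb ub; rewrite NE -(fineK (_ : muhat K \is a fin_num)) ?ge0_fin_numE//.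
rewrite -!EFinM lee_fin ler_pM2r// fine_gt0// Koo andbT lt_neqAle eq_sym K0.
exact: measure_ge0.
Qed.

Lemma ti_energy_frame f x : L2 mu f ->
  (A%:E * l2norm2 mu f <= ti_energy mu Gam g f x)%E /\
  (ti_energy mu Gam g f x <= B%:E * l2norm2 mu f)%E.
Proof.
move=> Lf; have := frame_g.2 (translate x f) (L2_translate scG haar_mu x Lf).
rewrite (l2norm2_translate scG haar_mu x (L2_cmeas Lf)).
rewrite (_ : \esum_(i in _) _ = ti_energy mu Gam g f x)//.
rewrite /ti_energy /ti_energy_j esum_esum; last first.
  by move=> j c _ _; rewrite lee_fin exprn_ge0 ?normc_ge0.
congr (esum _ _); apply/seteqP.
by split=> -[j c] /=; [move=> ?; split|case].
Qed.

Lemma ti_energy_j_ge0 f j x : (0 <= ti_energy_j mu Gam g f j x)%E.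
Proof. by apply: esum_ge0 => c _; rewrite lee_fin exprn_ge0 ?normc_ge0. Qed.

Lemma ti_energy_j_le f j x : (ti_energy_j mu Gam g f j x <= ti_energy mu Gam g f x)%E.
Proof.
apply: esum_ge; exists [set j]; first by split.
by rewrite fsbig_set1.
Qed.

Lemma ti_energy_j_periodization f j x : L2 mu f ->
  ti_energy_j mu Gam g f j x = periodization (Gam j) (U f j) x.
Proof.
move=> Lf; apply: eq_esum => c _; congr ((normc _ ^+ 2)%:E).
rewrite /orbit_coefficient /inner.
rewrite -[RHS](cintegral_translate scG haar_mu c).
  apply: eq_cintegral => y; rewrite /translate.
  by rewrite (_ : y - c - (x - c) = y - x)// opprB addrA subrK.
apply: cmeasurableM; last exact: cmeasurable_conj (L2_cmeas (L2g j)).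
exact: (cmeasurable_translate scG _ (L2_cmeas Lf)).
Qed.

(** In the upper frame inequality at [g j], the term of the index [(j, 0)] alone is
    the square of [l2norm2 mu (g j)]. *)
Lemma frame_generator_norm j : 0 <= B -> (l2norm2 mu (g j) <= B%:E)%E.
Proof.
move=> B0; have [_ ub] := frame_g.2 (g j) (L2g j).
have nE := fineK (L2_fin_num (L2g j)).
have : ((normc (inner mu (g j) (g j)) ^+ 2)%:E <= B%:E * l2norm2 mu (g j))%E.
  apply: le_trans ub; apply: esum_ge; exists [set (j, 0)]; first split=> //.
    by move=> _ ->; rewrite /ti_index /= rpred0.
  rewrite fsbig_set1 /ti_system /= (_ : translate 0 (g j) = g j)//.
  by apply/funext => y; rewrite /translate subr0.
rewrite inner_self// -nE -EFinM !lee_fin /= expr0n addr0 sqrtr_sqr.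
rewrite real_normK ?num_real// expr2.
set n := fine _; have n0 : 0 <= n by rewrite /n fine_ge0// l2norm2_ge0.
have := n0; rewrite le_eqVlt => /predU1P[<-//|npos].
by rewrite ler_pM2r.
Qed.

Lemma measurable_ti_energy_j f K j :
  measurable (K : set (borel (dual R G))) -> (muhat K < +oo)%E -> L2 mu f ->
  ae_eqc muhat (F f) (fun w => (\1_K w)%:C) ->
  measurable_fun setT (fun x : borel G => ti_energy_j mu Gam g f j x).
Proof.
move=> mK Koo Lf FfK.
have cGam := discrete_countable scG (latticeGam j).1.
have mU : measurable_fun setT (U f j).
  apply/measurable_EFinP; apply: measurable_normc_sqr.
  exact: (cmeasurable_orbit_coefficient lcG scG haar_mu plancherelF mK Koo Lf (L2g j) FfK).
have U0 x : (0 <= U f j x)%E by rewrite lee_fin exprn_ge0 ?normc_ge0.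
under eq_fun do rewrite ti_energy_j_periodization//.
exact: (measurable_periodization scG cGam mU U0).
Qed.

(** The energy of the index [j] is the periodization of the squared orbit coefficient,
    whose integral is at most [B] by [orbit_energy] and [frame_generator_norm].  Hence
    [periodization_mean] applies, on a packing set [P] with [1 / mu P] at most [c]. *)
Lemma ti_energy_j_mean f K j (c e : R) (H : nat -> set G) :
  measurable (K : set (borel (dual R G))) -> (muhat K < +oo)%E -> L2 mu f ->
  ae_eqc muhat (F f) (fun w => (\1_K w)%:C) ->
  0 <= B -> 0 <= c -> ((covol mu (Gam j))^-1 < c%:E)%E -> 0 < e -> van_hove mu H ->
  \forall n \near \oo, (\int[mu]_(x in (H n : set (borel G))) ti_energy_j mu Gam g f j x <=
    ((B * c + e) * fine (mu (H n)))%:E)%E.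
Proof.
move=> mK Koo Lf FfK B0 c0 covc e0 vhH.
have cGam := discrete_countable scG (latticeGam j).1.
have [P [mP Poo P0 Pc packP]] := finite_packing lcG scG haar_mu c0 cGam covc.
have mU : measurable_fun setT (U f j).
  apply/measurable_EFinP; apply: measurable_normc_sqr.
  exact: (cmeasurable_orbit_coefficient lcG scG haar_mu plancherelF mK Koo Lf (L2g j) FfK).
have U0 x : (0 <= U f j x)%E by rewrite lee_fin exprn_ge0 ?normc_ge0.
have UB : (\int[mu]_x U f j x <= B%:E)%E.
  apply: le_trans (frame_generator_norm j B0).
  exact: (orbit_energy lcG scG haar_mu plancherelF mK Koo Lf (L2g j) FfK).
have Uoo : (\int[mu]_x U f j x < +oo)%E by apply: le_lt_trans UB _; rewrite ltry.
have BN0 : 0 <= B * fine (l2norm2 mu f).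
  by rewrite mulr_ge0// fine_ge0// l2norm2_ge0.
have wM x : (periodization (Gam j) (U f j) x <= (B * fine (l2norm2 mu f))%:E)%E.
  rewrite -ti_energy_j_periodization// EFinM fineK ?L2_fin_num//.
  by apply: le_trans (ti_energy_j_le f j x) _; have [] := ti_energy_frame x Lf.
have := periodization_mean lcG scG haar_mu cGam mU U0 Uoo mP Poo P0 packP BN0 wM vhH e0.
apply: filterS => n; under eq_integral do rewrite -ti_energy_j_periodization//.
move=> h; apply: le_trans h _; rewrite lee_fin ler_wpM2r ?fine_ge0// lerD2r.
apply: ler_pM => //.
- by apply: fine_ge0; exact: integral_ge0.
- by rewrite -lee_fin fineK// ge0_fin_numE//; exact: integral_ge0.
Qed.

Lemma bandwidth_ge (J1 : {fset J}) :
  (\sum_(j <- J1) (covol mu (Gam j))^-1 <= bandwidth mu Gam)%E.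
Proof.
apply: esum_ge; exists [set` J1]; first by split.
by rewrite fsbig_finite// set_fsetK.
Qed.

Lemma covol_ge0 j : (0 <= covol mu (Gam j))%E.
Proof.
have [ne|ne] := pselect (exists x, [set mu D | D in fundamental_domain mu (Gam j)] x).
  have [D _ DE] : [set mu D | D in fundamental_domain mu (Gam j)] (covol mu (Gam j)).
    exact: getPex.
  by rewrite -DE measure_ge0.
have -> : covol mu (Gam j) = point by apply: getPN => x Dx; apply: ne; exists x.
exact: lexx.
Qed.

Hypothesis ucp : UCP1 mu muhat F E Gam g.

(** Test the convergence property on the [f] whose transform is the indicator of
    [K].  The lower frame bound holds at every translate of [f], hence for the mean of
    the energy; up to an arbitrarily small error this mean is that of a finite sum
    over [J1], whose terms are bounded by [ti_energy_j_mean]. *)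
Lemma window_bound (K : set (dual R G)) : compact K -> K `<=` ~` E -> 0 <= B ->
  (bandwidth mu Gam < +oo)%E -> (A%:E * muhat K <= B%:E * bandwidth mu Gam)%E.
Proof.
move=> cK KE B0 BWoo.
have mK := compact_dual_borel cK.
have Koo : (muhat K < +oo)%E by exact: haar_compact.
have [f [Lf FfK NE]] := plancherel_indic cK.
have LFf := plancherel_L2 plancherelF Lf.
have tf : test_fun mu muhat F E f.
  split=> //; first split; first exact: L2_cmeas LFf.
    exists 1; apply: filterS FfK => w ->; rewrite normc_indic indicE.
    by case: (_ \in _); rewrite ?lexx ?ler01.
  exists K; split=> //; apply: filterS FfK => w ->.
  by rewrite -rmorphM /= indicE; case: (_ \in _); rewrite ?mulr1 ?mulr0.
have [Wfin [Wc _ _] Weps] := ucp tf.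
pose N := fine (muhat K); have NK : muhat K = N%:E by rewrite fineK// ge0_fin_numE.
have N0 : 0 <= N by exact: fine_ge0.
pose W x := fine (ti_energy mu Gam g f x).
pose Wj j x := fine (ti_energy_j mu Gam g f j x).
have WE x : ti_energy mu Gam g f x = (W x)%:E by rewrite fineK.
have WjE j x : ti_energy_j mu Gam g f j x = (Wj j x)%:E.
  rewrite fineK// ge0_fin_numE ?ti_energy_j_ge0//.
  by apply: le_lt_trans (ti_energy_j_le f j x) _; rewrite WE ltry.
have Wj0 j x : 0 <= Wj j x by rewrite -lee_fin -WjE ti_energy_j_ge0.
have WB x : A * N <= W x <= B * N.
  have [lb ub] := ti_energy_frame x Lf.
  by rewrite -!lee_fin !EFinM -WE -NK -NE lb ub.
have WjB j x : Wj j x <= B * N.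
  rewrite (le_trans _ (andP (WB x)).2)// -lee_fin -WE -WjE.
  exact: ti_energy_j_le.
pose b := fine (bandwidth mu Gam).
have bE : bandwidth mu Gam = b%:E.
  rewrite fineK// ge0_fin_numE//; apply: esum_ge0 => j _.
  by rewrite inve_ge0 covol_ge0.
pose c j := fine (covol mu (Gam j))^-1%E.
have cE j : (covol mu (Gam j))^-1%E = (c j)%:E.
  rewrite fineK// ge0_fin_numE ?inve_ge0 ?covol_ge0//.
  by apply: le_lt_trans BWoo; have := bandwidth_ge [fset j]%fset; rewrite big_seq_fset1.
have c0 j : 0 <= c j by rewrite -lee_fin -cE inve_ge0 covol_ge0.
rewrite bE NK -!EFinM lee_fin; apply/ler_addgt0Pr => eps eps0.
have [J1 HJ1] := Weps (eps / 2) (divr_gt0 eps0 (ltr0n _ 2)).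
have [m [[H vhH] mH] meps] := HJ1 J1 (fsubset_refl _).
pose d x := `|W x - \sum_(j <- J1) Wj j x|.
have {}mH := mH H vhH.
pose s : R := (size J1)%:R.
have s0 : 0 <= s by exact: ler0n.
(* Each of the [s] summands has the error [B * e + e], of which [B * e] comes from the
   inverse covolume and [e] from the mean. *)
pose e := eps / 2 / ((s + 1) * (B + 1)).
have e0 : 0 < e by rewrite !divr_gt0 ?mulr_gt0// ltr_wpDl.
have es : s * (B * e + e) <= eps / 2.
  rewrite (_ : s * _ = e * (s * (B + 1))); last by ring.
  rewrite /e mulrAC ler_pdivrMr ?mulr_gt0 ?ltr_wpDl// ler_pM2l ?divr_gt0//.
  by rewrite ler_pM2r ?ltr_wpDl// lerDl.
have near1 : \forall n \near \oo, (fine (mu (H n)))^-1 * Rintegral mu (H n) d < eps / 2.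
  exact: (cvgr_lt _ mH).
have near2 : \forall n \near \oo, forall j, j \in (J1 : seq J) ->
    (\int[mu]_(x in (H n : set (borel G))) ti_energy_j mu Gam g f j x <=
    ((B * (c j + e) + e) * fine (mu (H n)))%:E)%E.
  apply: near_all_seq => j _.
  have c1 : 0 <= c j + e by rewrite addr_ge0// ltW.
  have c2 : ((covol mu (Gam j))^-1 < (c j + e)%:E)%E by rewrite cE lte_fin ltrDl.
  exact: (ti_energy_j_mean mK Koo Lf FfK B0 c1 c2 e0 vhH).
have [n [n1 n2]] := filter_ex (filterI near1 near2).
have [Hn0 oH pH] : [/\ H n !=set0, open (H n) & precompact (H n)] by case: vhH.
have mHn : measurable (H n : set (borel G)) by exact: open_borel.
have Hoo : (mu (H n) < +oo)%E by exact: (precompact_finite haar_mu oH pH).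
pose h := fine (mu (H n)).
have hE : mu (H n) = h%:E by rewrite fineK// ge0_fin_numE.
have h0 : 0 < h.
  rewrite -lte_fin -hE lt_neqAle measure_ge0 andbT eq_sym.
  exact: (haar_open_neq0 scG haar_mu oH Hn0).
have mtj j := measurable_ti_energy_j j mK Koo Lf FfK.
have mWj j : measurable_fun setT (fun x : borel G => Wj j x).
  apply/measurable_EFinP; rewrite (_ : _ \o _ = fun x => ti_energy_j mu Gam g f j x)//.
  by apply/funext => x; rewrite WjE.
have mW : measurable_fun setT (fun x : borel G => W x).
  apply: measurable_fun_openR => O oO; apply: open_borel.
  by have /continuousP/(_ O oO) := Wc.
have md : measurable_fun setT (fun x : borel G => (d x)%:E).
  apply/measurable_EFinP; apply: measurableT_comp => //.
  by apply: measurable_realfun.measurable_funB => //; exact: measurable_sum.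
have d0 x : (0 <= (d x)%:E)%E by rewrite lee_fin /d normr_ge0.
have W0 x : 0 <= W x by rewrite -lee_fin -WE; apply: esum_ge0 => j _; exact: ti_energy_j_ge0.
have step1 : ((A * N * h)%:E <= \int[mu]_(x in (H n : set (borel G))) (W x)%:E)%E.
  rewrite EFinM -hE -(integral_cst mu mHn); apply: ge0_le_integral; first exact: mHn.
  - by move=> x _; rewrite lee_fin mulr_ge0// ltW// frame_g.1.
  - exact: measurable_cst.
  - by apply: measurable_funTS; exact/measurable_EFinP.
  - by move=> x _; rewrite lee_fin (andP (WB x)).1.
have step2 : (\int[mu]_(x in (H n : set (borel G))) (W x)%:E <=
    \int[mu]_(x in (H n : set (borel G))) (d x)%:E +
    \sum_(j <- J1) \int[mu]_(x in (H n : set (borel G))) ti_energy_j mu Gam g f j x)%E.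
  rewrite -ge0_integral_sum//; last 2 first.
  - by move=> j; exact: measurable_funTS.
  - by move=> j x _; exact: ti_energy_j_ge0.
  rewrite -ge0_integralD//; last 3 first.
  - exact: measurable_funTS.
  - by move=> x _; apply: sume_ge0 => j _; exact: ti_energy_j_ge0.
  - by apply: emeasurable_sum => j; exact: measurable_funTS.
  apply: ge0_le_integral; first exact: mHn.
  - by move=> x _; rewrite lee_fin W0.
  - by apply: measurable_funTS; exact/measurable_EFinP.
  - apply: emeasurable_funD; first exact: measurable_funTS.
    by apply: emeasurable_sum => j; exact: measurable_funTS.
  - move=> x _; under eq_bigr do rewrite WjE.
    rewrite sumEFin -EFinD lee_fin -lerBlDr; exact: ler_norm.
have dfin : (\int[mu]_(x in (H n : set (borel G))) (d x)%:E < +oo)%E.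
  apply: (@le_lt_trans _ _ ((B * N + s * (B * N))%:E * mu (H n))%E); last first.
    by rewrite hE -EFinM ltry.
  rewrite -(integral_cst mu mHn); apply: ge0_le_integral; first exact: mHn.
  - by move=> x _; exact: d0.
  - exact: measurable_funTS.
  - exact: measurable_cst.
  - move=> x _; rewrite lee_fin (le_trans (ler_normB _ _))//; apply: lerD.
      by rewrite ger0_norm// (andP (WB x)).2.
    rewrite ger0_norm; last by apply: sumr_ge0 => j _; exact: Wj0.
    apply: (@le_trans _ _ (\sum_(j <- J1) B * N)); first by apply: ler_sum => j _; exact: WjB.
    by rewrite big_const_seq count_predT iter_addr_0 mulr_natl.
have step3 : (\int[mu]_(x in (H n : set (borel G))) (d x)%:E)%E = (Rintegral mu (H n) d)%:E.
  by rewrite fineK// ge0_fin_numE//; exact: integral_ge0.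
have step4 : (\sum_(j <- J1) \int[mu]_(x in (H n : set (borel G))) ti_energy_j mu Gam g f j x
    <= (\sum_(j <- J1) (B * (c j + e) + e) * h)%:E)%E.
  by rewrite -sumEFin big_seq [leRHS]big_seq; apply: lee_sum => j jJ; exact: n2.
have sumE : \sum_(j <- J1) (B * (c j + e) + e) * h =
    (B * \sum_(j <- J1) c j + s * (B * e + e)) * h.
  rewrite -mulr_suml; congr (_ * _).
  rewrite (eq_bigr (fun j => B * c j + (B * e + e))); last by move=> j _; ring.
  by rewrite big_split /= mulr_sumr big_const_seq count_predT iter_addr_0 mulr_natl.
have csum : \sum_(j <- J1) c j <= b.
  rewrite -lee_fin -bE -sumEFin; under eq_bigr do rewrite -cE.
  exact: bandwidth_ge.
have Rlt : Rintegral mu (H n) d < eps / 2 * h.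
  by move: n1; rewrite mulrC ltr_pdivrMr.
have : A * N * h <= eps / 2 * h + (B * b + eps / 2) * h.
  rewrite -lee_fin; apply: le_trans step1 _; apply: le_trans step2 _.
  rewrite step3 EFinD; apply: leeD; first by rewrite lee_fin ltW.
  apply: le_trans step4 _; rewrite sumE lee_fin ler_pM2r//.
  by apply: lerD => //; exact: ler_wpM2l.
rewrite -mulrDl ler_pM2r// => /le_trans; apply.
by rewrite addrCA -splitr.
Qed.
End translation_frames.

(** * The total mass of the dual of a nondiscrete group *)

Section total_mass_of_dual.
Context {R : realType} {G : topologicalZmodType}.
Hypotheses (hausG : hausdorff_space G).
Hypotheses (lcG : locally_compact [set: G]) (scG : @second_countable G).
Variables (mu : {measure set (borel G) -> \bar R}) (haar_mu : haar_measure mu).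
Variables (muhat : {measure set (borel (dual R G)) -> \bar R}).
Hypothesis haar_muhat : haar_measure muhat.
Variables (F : (G -> R[i]) -> dual R G -> R[i])
          (plancherelF : fourier_plancherel mu muhat F).
Import ComplexField.Normc.
Local Notation "x %:C" := (real_complex _ x).

(** The transform of the indicator of [U] has square integral [mu U], but its
    modulus is at most [mu U] everywhere.  The factor 2 comes from bounding the real
    and the imaginary part separately. *)
Lemma open_measure_lower_bound (U : set G) : open U -> U !=set0 -> (mu U < +oo)%E ->
  (muhat setT < +oo)%E -> 1 <= 2 * fine (mu U) * fine (muhat setT).
Proof.
move=> oU U0 Uoo Doo.
have mU : measurable (U : set (borel G)) by exact: open_borel.
have LU := L2_indic mU Uoo.
have iU : mu.-integrable setT (fun x => (\1_U x : R)%:E).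
  apply/integrableP; split; first by apply/measurable_EFinP; exact: measurable_indic.
  under eq_integral do rewrite gee0_abs ?lee_fin ?indicE//.
  by rewrite integral_indic// setIT.
have L1U : L1 mu (fun x => (\1_U x : R)%:C).
  by apply: (L1_le (L2_cmeas LU) iU) => x; rewrite normc_indic.
have LF := plancherel_L2 plancherelF LU.
pose r := fine (mu U); have rE : mu U = r%:E by rewrite fineK// ge0_fin_numE.
have r0 : 0 < r.
  by rewrite -lte_fin -rE lt_neqAle measure_ge0 andbT eq_sym (haar_open_neq0 scG haar_mu).
pose t := fine (muhat setT); have tE : muhat setT = t%:E by rewrite fineK// ge0_fin_numE.
have bound w : normc (fourier mu (fun x => (\1_U x : R)%:C) w) ^+ 2 <= 2 * r ^+ 2.
  have [i1 i2] := (L1P _ _).1 (fourier_integrand_L1 lcG scG w L1U).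
  have small (p : R[i] -> R) : (forall z, `|p z| <= normc z) ->
      mu.-integrable setT (fun x => (p ((\1_U x : R)%:C * (w x)^*))%:E) ->
      `|Rintegral mu setT (fun x : borel G => p ((\1_U x : R)%:C * (w x)^*))| <= r.
    move=> pz ip; apply: le_trans (le_normr_Rintegral measurableT ip) _.
    rewrite (_ : r = Rintegral mu setT (fun x => \1_U x : R)); last first.
      by rewrite /Rintegral integral_indic// setIT.
    apply: le_Rintegral => //; first by move: (integrable_norm ip).
    by move=> x _; rewrite (le_trans (pz _))// normcM normc_indic normc_char mulr1.
  rewrite normc_sqr mulr_natl mulr2n; apply: lerD.
  - rewrite -[leLHS]real_normK ?num_real// lerXn2r ?nnegrE ?(ltW r0)//.
    exact: (small _ (@Re_le_normc R) i1).
  - rewrite -[leLHS]real_normK ?num_real// lerXn2r ?nnegrE ?(ltW r0)//.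
    exact: (small _ (@Im_le_normc R) i2).
have : (mu U <= ((2 * r ^+ 2) * t)%:E)%E.
  rewrite -{1}(l2norm2_indic mu mU) -(plancherel_l2norm2 plancherelF LU).
  rewrite EFinM -tE -integral_cst//.
  apply: ae_ge0_le_integral => //.
  - by move=> w _; rewrite lee_fin exprn_ge0 ?normc_ge0.
  - by apply/measurable_EFinP; apply: measurable_normc_sqr; exact: L2_cmeas LF.
  - by move=> w _; rewrite lee_fin mulr_ge0// sqr_ge0.
  - have := plancherel_fourier plancherelF L1U LU.
    by apply: filterS => w -> _; rewrite lee_fin.
rewrite rE lee_fin expr2 -/t => h.
rewrite -(ler_pM2r r0) mul1r; apply: le_trans h _.
by rewrite le_eqVlt; apply/orP; left; apply/eqP => /=; ring.
Qed.

(** If the dual has finite mass, [open_measure_lower_bound] bounds the measures of the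
    neighbourhoods of 0 from below, so that 0 has positive mass by outer regularity.
    A neighbourhood of 0 with less than twice this mass contains no other point. *)
Lemma finite_dual_discrete : (muhat setT < +oo)%E -> discrete_subset [set: G].
Proof.
move=> Doo.
have c1 (x : G) : measurable ([set x] : set (borel G)).
  by apply: closed_borel; apply: compact_closed => //; exact: compact_set1.
pose t := fine (muhat setT).
have t0 : 0 < t.
  by rewrite fine_gt0// Doo andbT lt_neqAle eq_sym (haar_neq0 haar_muhat) measure_ge0.
have a0 : (((2 * t)^-1)%:E <= mu [set (0%R : G)])%E.
  rewrite (haar_outer haar_mu (c1 0)); apply: le_ereal_inf_tmp => _ [U [oU U0] <-].
  have [Uoo|] := ltP (mu U) +oo%E; last by rewrite leye_eq => /eqP ->; rewrite leey.
  have Une : U !=set0 by exists 0; apply: U0.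
  have := open_measure_lower_bound oU Une Uoo Doo.
  rewrite -/t -(fineK (_ : mu U \is a fin_num)) ?ge0_fin_numE// lee_fin => h.
  by rewrite -div1r ler_pdivrMr ?mulr_gt0//; rewrite mulrCA mulrA.
have aoo : (mu [set (0%R : G)] < +oo)%E by apply: (haar_compact haar_mu); exact: compact_set1.
have apos : (0 < mu [set (0%R : G)])%E.
  by apply: lt_le_trans a0; rewrite lte_fin invr_gt0 mulr_gt0.
pose a := fine (mu [set (0%R : G)]).
have aE : mu [set (0%R : G)] = a%:E by rewrite fineK// ge0_fin_numE.
have : (ereal_inf [set mu U | U in [set U : set G | open U /\ [set (0%R : G)] `<=` U]] < (a + a)%:E)%E.
  by rewrite -(haar_outer haar_mu (c1 0)) aE lte_fin ltrDl -lte_fin -aE.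
move=> /ereal_inf_lt[_ [U [oU U0] <-]] U2.
have U1 : U = [set 0].
  apply/seteqP; split=> // y Uy; apply: contrapT => /eqP y0.
  move: U2; rewrite ltNge => /negP; apply.
  have my : mu [set y] = mu [set (0%R : G)].
    rewrite -(haar_shift haar_mu y (c1 0)); congr (mu _).
    by rewrite image_set1 addr0.
  rewrite EFinD -aE -{1}my.
  have -> : (mu [set y] + mu [set (0%R : G)] = mu ([set y] `|` [set (0%R : G)]))%E.
    rewrite measureU//; apply/seteqP; split=> // z [/= -> /eqP].
    by rewrite (negbTE y0).
  apply: le_measure; rewrite ?inE; [exact: measurableU|exact: open_borel|].
  by move=> z [->//|]; exact: U0.
move=> x _; split; first by rewrite inE.
exists ((fun y => y - x) @^-1` U).
  apply: open_nbhs_nbhs; split; last by rewrite /= subrr; exact: U0.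
  by have /continuousP/(_ U oU) := @translation_continuous _ x.
rewrite setIT U1; apply/seteqP; split=> y /=; first by move/eqP; rewrite subr_eq0 => /eqP.
by move=> ->; rewrite subrr.
Qed.
End total_mass_of_dual.

Theorem theorem3p14 (R : realType) (G : topologicalZmodType)
    (hausG : hausdorff_space G) (lcG : locally_compact [set: G])
    (scG : @second_countable G)
    (mu : {measure set (borel G) -> \bar R}) (haar_mu : haar_measure mu)
    (muhat : {measure set (borel (dual R G)) -> \bar R})
    (haar_muhat : haar_measure muhat)
    (F : (G -> R[i]) -> dual R G -> R[i])
    (plancherelF : fourier_plancherel mu muhat F)
    (E : set (dual R G)) (closedE : closed E) (nullE : muhat E = 0%E)
    (J : countType) (Gam : J -> zmodClosed G)
    (latticeGam : forall j, lattice (Gam j))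
    (g : J -> G -> R[i]) (L2g : forall j, L2 mu (g j))
    (A B : R) (frame_g : frame mu (ti_index Gam) (ti_system g) A B)
    (ucp : UCP1 mu muhat F E Gam g) :
  ((A / B)%:E * muhat [set: dual R G] <= bandwidth mu Gam)%E /\
  (~ discrete_subset [set: G] -> bandwidth mu Gam = +oo%E).
Proof.
have A0 : 0 < A by exact: frame_g.1.
have B0 : 0 < B.
  exact: lt_le_trans A0 (frame_bounds_le lcG haar_muhat plancherelF frame_g).
have bound : ((A / B)%:E * muhat [set: dual R G] <= bandwidth mu Gam)%E.
  have [BWoo|] := ltP (bandwidth mu Gam) +oo%E; last first.
    by rewrite leye_eq => /eqP ->; rewrite leey.
  have mE : measurable (E : set (borel (dual R G))) by exact: closed_borel.
  (* Only compact sets off [E] are tested, which suffices because [E] is null. *)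
  have -> : muhat [set: dual R G] = muhat (~` E).
    rewrite -(setUv E) setUC measureU//; [|exact: measurableC|by rewrite setICl].
    by rewrite -[RHS]adde0; congr (_ + _)%E; exact: nullE.
  rewrite (haar_inner haar_muhat (closed_openC closedE)).
  have AB0 : 0 < A / B by rewrite divr_gt0.
  rewrite -lee_pdivlMl//.
  apply: ge_ereal_sup => _ [K [cK KE] <-]; rewrite lee_pdivlMl//.
  have := window_bound lcG scG haar_mu haar_muhat plancherelF latticeGam L2g
    frame_g ucp cK KE (ltW B0) BWoo.
  rewrite -lee_pdivrMl// => h; apply: le_trans h.
  by rewrite muleA -EFinM mulrC.
split=> // nd.
have muhatoo : muhat [set: dual R G] = +oo%E.
  apply/eqP; rewrite -leye_eq leNgt; apply/negP => Doo; apply: nd.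
  exact: (finite_dual_discrete hausG lcG scG haar_mu haar_muhat plancherelF Doo).
apply/eqP; rewrite -leye_eq; apply: le_trans bound.
by rewrite muhatoo gt0_muley// lte_fin divr_gt0.
Qed.
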